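(* Let $D$ be a database and let $\Sigma$ be a finite set of linear TGDs. Let $d=|\mathsf{sch}(\Sigma)|\cdot\mathsf{ar}(\Sigma)^{\mathsf{ar}(\Sigma)+1}$ and $f_{\mathsf{L}}(\Sigma)=(d+1)\cdot\|\Sigma\|^{2\cdot\mathsf{ar}(\Sigma)\cdot(d+1)}$. The following are equivalent: (1) $\Sigma\in\mathsf{CT}_D$, i.e., $\mathsf{chase}(D,\Sigma)$ is finite. (2) $|\mathsf{chase}(D,\Sigma)|\le|D|\cdot f_{\mathsf{L}}(\Sigma)$. (3) $\mathsf{simple}(\Sigma)$ is $\mathsf{simple}(D)$-weakly-acyclic.
   Context: **Basics.** $\mathbf{C},\mathbf{N},\mathbf{V}$ are disjoint countably infinite sets of constants, nulls and variables; their elements are terms. A schema is a finite set of predicates, each with an arity $>0$. An atom is $R(\bar t)$ with $\bar t$ a tuple of terms of length the arity of $R$; a fact is an atom with only constants. An instance is a (possibly infinite) set of atoms over constants and nulls; a database is a finite set of facts. $|\cdot|$ is cardinality. A homomorphism from a set of atoms $A$ to a set of atoms $B$ maps terms of $A$ to terms of $B$, is the identity on $\mathbf{C}$, and maps atoms of $A$ to atoms of $B$. **TGDs.** A TGD $\sigma$ is a constant-free sentence $\forall\bar x\forall\bar y(\phi(\bar x,\bar y)\to\exists\bar z\,\psi(\bar x,\bar z))$ with $\phi$ (the body) and $\psi$ (the head) non-empty conjunctions of atoms over the variables $\bar x\cup\bar y$ and $\bar x\cup\bar z$; conjunctions are identified with sets of atoms. The frontier $\mathsf{fr}(\sigma)$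 is the set of variables $\bar x$ occurring in both body and head. A TGD is linear if its body is a single atom; it is simple linear if moreover no variable occurs more than once in that atom. For a finite set $\Sigma$ of TGDs (no two sharing a variable, w.l.o.g.), $\mathsf{sch}(\Sigma)$ is the set of predicates occurring in $\Sigma$, $\mathsf{ar}(\Sigma)$ their maximum arity, $\mathsf{atoms}(\Sigma)$ the set of atoms occurring in the TGDs of $\Sigma$, and $\|\Sigma\|=|\mathsf{atoms}(\Sigma)|\cdot|\mathsf{sch}(\Sigma)|\cdot\mathsf{ar}(\Sigma)$. **Semi-oblivious chase.** A trigger for $\Sigma$ on an instance $I$ is $(\sigma,h)$ with $\sigma\in\Sigma$ and $h$ a homomorphism from $\mathsf{body}(\sigma)$ to $I$. Its result $\mathsf{result}(\sigma,h)$ is $\mu(\mathsf{head}(\sigma))$, where $\mu(x)=h(x)$ if $x\in\mathsf{fr}(\sigma)$ and otherwise $\mu(x)$ is the null $\bot^x_{\sigma,h_{|\mathsf{fr}(\sigma)}}$, uniquely determined by $x$, $\sigma$ and the restriction of $h$ to $\mathsf{fr}(\sigma)$. The trigger is active if $\mathsf{result}(\sigma,h)\not\subseteq I$; applying it yields $I\cup\mathsf{result}(\sigma,h)$. A valid chase derivation of $D$ w.r.t. $\Sigma$ is a sequence of instances starting with $D$, each next one obtained by applying an active trigger, that is either finite with no active trigger on the last instance, or infinite and fair (every trigger active on some $I_i$ is not active on some later $I_j$). Its result is the union of its instances; all valid derivations have the same result, denoted $\mathsf{chase}(D,\Sigma)$. $\mathsf{CT}_D$ is the class of sets $\Sigma$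 of TGDs such that $\mathsf{chase}(D,\Sigma)$ is finite. **Simplification.** For a tuple of terms $\bar t=(t_1,\ldots,t_n)$, $\mathsf{unique}(\bar t)$ is obtained by keeping only the first occurrence of each term; $\mathsf{id}_{\bar t}(t_i)$ is the position of $t_i$ in $\mathsf{unique}(\bar t)$, and $\mathsf{id}(\bar t)=(\mathsf{id}_{\bar t}(t_1),\ldots,\mathsf{id}_{\bar t}(t_n))$. (E.g. for $\bar t=(x,y,x,z,y)$: $\mathsf{unique}(\bar t)=(x,y,z)$, $\mathsf{id}(\bar t)=(1,2,1,3,2)$.) The simplification of an atom $R(\bar t)$ is $\mathsf{simple}(R(\bar t))=R_{\mathsf{id}(\bar t)}(\mathsf{unique}(\bar t))$, where each $R_{\mathsf{id}(\bar t)}$ is a new predicate; the simplification of a set (or conjunction) of atoms is taken atomwise, giving $\mathsf{simple}(D)$. A specialization of a tuple of variables $\bar x=(x_1,\ldots,x_n)$ is a function $f$ from the variables of $\bar x$ to the variables of $\bar x$ with $f(x_1)=x_1$ and $f(x_i)\in\{f(x_1),\ldots,f(x_{i-1}),x_i\}$ for $2\le i\le n$. For a linear TGD $\sigma=R(\bar x)\to\exists\bar z\,\psi(\bar y,\bar z)$ with $\bar y\subseteq\bar x$, and a specialization $f$ of $\bar x$, the simplification of $\sigma$ induced by $f$ is the simple linear TGD $\mathsf{simple}(R(f(\bar x)))\to\exists\bar z\,\mathsf{simple}(\psi(f(\bar y),\bar z))$. $\mathsf{simple}(\sigma)$ is the set of all of these over all specializations $f$ of $\bar x$, and $\mathsf{simple}(\Sigma)=\bigcup_{\sigma\in\Sigma}\mathsf{simple}(\sigma)$.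 **Non-uniform weak-acyclicity** (for a set $\Sigma$ of TGDs and a database $D$). The dependency graph $\mathsf{dg}(\Sigma)$ is the directed multigraph whose nodes are the positions $(R,i)$ with $R\in\mathsf{sch}(\Sigma)$, $1\le i\le$ arity of $R$, and whose edges are exactly: for each $\sigma\in\Sigma$, each $x\in\mathsf{fr}(\sigma)$ and each position $\pi$ at which $x$ occurs in $\mathsf{body}(\sigma)$, a normal edge from $\pi$ to each position at which $x$ occurs in an atom of $\mathsf{head}(\sigma)$, and a special edge from $\pi$ to each position at which an existentially quantified variable of $\sigma$ occurs in an atom of $\mathsf{head}(\sigma)$. For $R,P\in\mathsf{sch}(\Sigma)$ write $R\to_\Sigma P$ if $R=P$ or some $\sigma\in\Sigma$ has $R$ in its body and $P$ in its head; $\rightsquigarrow_\Sigma$ is the transitive closure of $\to_\Sigma$. A (not necessarily simple, possibly cyclic) path in $\mathsf{dg}(\Sigma)$ is $D$-supported if there are $R(\bar t)\in D$ and a node $(P,i)$ on the path with $R\rightsquigarrow_\Sigma P$. $\Sigma$ is $D$-weakly-acyclic if $\mathsf{dg}(\Sigma)$ has no $D$-supported cycle containing a special edge. *)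

(* Defs.v *)
From HB Require Import structures.
From Stdlib Require Import Relation_Operators.
From mathcomp Require Import all_boot finmap.
From mathcomp Require Import boolp classical_sets functions cardinality.

Set Implicit Arguments.
Unset Strict Implicit.
Unset Printing Implicit Defensive.

Local Open Scope fset_scope.

(* ------------------------------ Terms and atoms --------------------------- *)

Definition const : Type := nat.
Definition null : Type := nat.
Definition var : Type := nat.

(* The terms of instances.  Variables occur only in TGDs. *)
Definition term : Type := (const + null)%type.

(* A universe of predicates; schemas are finite subsets of it. *)
Record signature := Signature {
  predicate : countType;
  arity : predicate -> nat;
  arity_gt0 : forall R : predicate, 0 < arity R
}.

Record atom (S : signature) (T : Type) := Atom {
  atom_val : predicate S * seq T;
  _ : size atom_val.2 == arity atom_val.1
}.

HB.instance Definition _ S T := [isSub for @atom_val S T].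
HB.instance Definition _ S (T : eqType) := [Equality of atom S T by <:].
HB.instance Definition _ S (T : choiceType) := [Choice of atom S T by <:].
HB.instance Definition _ S (T : countType) := [Countable of atom S T by <:].

Definition pred_of S T (a : atom S T) : predicate S := (atom_val a).1.
Definition args S T (a : atom S T) : seq T := (atom_val a).2.

Lemma size_args S T (a : atom S T) : size (args a) = arity (pred_of a).
Proof. exact/eqP/(valP a). Qed.

Lemma map_atom_subproof S T U (f : T -> U) (a : atom S T) :
  size (pred_of a, map f (args a)).2 == arity (pred_of a, map f (args a)).1.
Proof. by rewrite /= size_map size_args. Qed.

Definition map_atom S T U (f : T -> U) (a : atom S T) : atom S U :=
  Atom (map_atom_subproof f a).

(* ----------------------------------- TGDs --------------------------------- *)

(* A TGD is the pair (body, head) of non-empty finite sets of atoms over      *)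
(* variables; the quantifiers are recovered from where the variables occur.   *)
Record tgd (S : signature) := Tgd {
  tgd_val : {fset atom S var} * {fset atom S var};
  _ : (tgd_val.1 != fset0) && (tgd_val.2 != fset0)
}.

HB.instance Definition _ S := [isSub for @tgd_val S].
HB.instance Definition _ S := [Countable of tgd S by <:].

Section TGD.
Variable S : signature.
Implicit Types (A : {fset atom S var}) (s : tgd S) (Sigma : {fset tgd S}).

Definition body_of s : {fset atom S var} := (tgd_val s).1.
Definition head_of s : {fset atom S var} := (tgd_val s).2.

Definition vars A : {fset var} := \bigcup_(a <- A) [fset x in args a].

Definition frontier s : {fset var} := vars (body_of s) `&` vars (head_of s).
Definition existential s : {fset var} := vars (head_of s) `\` vars (body_of s).

Definition linear s : Prop := exists a, body_of s = [fset a].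

Definition variable_disjoint Sigma : Prop :=
  forall s t, s \in Sigma -> t \in Sigma -> s <> t ->
    [disjoint vars (body_of s `|` head_of s) & vars (body_of t `|` head_of t)].

Definition atoms Sigma : {fset atom S var} :=
  \bigcup_(s <- Sigma) (body_of s `|` head_of s).
Definition sch Sigma : {fset predicate S} := [fset pred_of a | a in atoms Sigma].
Definition ar Sigma : nat := \max_(R <- sch Sigma) arity R.
Definition tgd_norm Sigma : nat := #|` atoms Sigma| * #|` sch Sigma| * ar Sigma.

Definition d_L Sigma : nat := #|` sch Sigma| * ar Sigma ^ (ar Sigma).+1.
Definition f_L Sigma : nat :=
  (d_L Sigma).+1 * tgd_norm Sigma ^ (2 * ar Sigma * (d_L Sigma).+1).

End TGD.

(* --------------------------- Semi-oblivious chase ------------------------- *)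

Section Chase.
Variable S : signature.
Implicit Types (D : {fset atom S const}) (s : tgd S) (Sigma : {fset tgd S}).
Implicit Types (I J X : set (atom S term)) (h : var -> term).
Implicit Types u : nat -> set (atom S term).

Local Open Scope classical_set_scope.

(* TGDs contain neither constants nor nulls, so a homomorphism from a set of  *)
(* their atoms is just an assignment of terms to variables; only its values   *)
(* on the variables of A matter.                                              *)
Definition homomorphism h (A : {fset atom S var}) I : Prop :=
  forall a, a \in A -> I (map_atom h a).

Definition restrict h (A : {fset var}) : {fmap var -> term} :=
  [fmap y : A => h (val y)]%fmap.

(* The null named after x, s and the restriction of h to the frontier of s;   *)
(* pickle is injective, so distinct names give distinct nulls.                *)
Definition null_of s h (x : var) : null :=
  choice.pickle (x, s, restrict h (frontier s)).

Definition result s h : set (atom S term) :=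
  let mu x := if x \in frontier s then h x else inr (null_of s h x) in
  [set map_atom mu a | a in [set` head_of s]].

Definition trigger Sigma I s h : Prop :=
  s \in Sigma /\ homomorphism h (body_of s) I.

Definition active Sigma I s h : Prop :=
  trigger Sigma I s h /\ ~ result s h `<=` I.

Definition chase_step Sigma I J : Prop :=
  exists s h, active Sigma I s h /\ J = I `|` result s h.

Definition instance_of D : set (atom S term) :=
  [set map_atom (inl : const -> term) a | a in [set` D]].

Definition finite_derivation D Sigma u n : Prop :=
  [/\ u 0 = instance_of D,
      forall i, i < n -> chase_step Sigma (u i) (u i.+1) &
      forall s h, ~ active Sigma (u n) s h].

Definition fair Sigma u : Prop :=
  forall i s h, active Sigma (u i) s h ->
    exists2 j, i < j & ~ active Sigma (u j) s h.

Definition infinite_derivation D Sigma u : Prop :=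
  [/\ u 0 = instance_of D,
      forall i, chase_step Sigma (u i) (u i.+1) &
      fair Sigma u].

Definition chase_result D Sigma X : Prop :=
  (exists u n, finite_derivation D Sigma u n /\
     X = \bigcup_(i in [set i | i <= n]) u i) \/
  (exists u, infinite_derivation D Sigma u /\ X = \bigcup_i u i).

(* Valid derivations exist and all have the same result; set0 is never used.  *)
Definition chase D Sigma : set (atom S term) :=
  xget set0 [set X | chase_result D Sigma X].

Definition CT D Sigma : Prop := finite_set (chase D Sigma).

End Chase.

(* ------------------------------ Simplification ---------------------------- *)

(* undup keeps the last occurrence of each item, hence the reversals. *)
Definition unique (T : eqType) (t : seq T) : seq T := rev (undup (rev t)).

Definition id_of (T : eqType) (t : seq T) : seq nat :=
  [seq (index x (unique t)).+1 | x <- t].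

(* The predicate R_ids is encoded as the atom R(ids) over nat.  Its arity is  *)
(* the number of distinct entries of ids.                                     *)
Lemma simple_arity_gt0 S (R : atom S nat) : 0 < size (undup (args R)).
Proof.
have := arity_gt0 (pred_of R); rewrite -size_args.
by rewrite !lt0n !size_eq0; apply: contra => /eqP/undup_nil ->.
Qed.

Definition simple_signature (S : signature) : signature :=
  Signature (@simple_arity_gt0 S).

Lemma mem_unique (T : eqType) (t : seq T) : unique t =i t.
Proof. by move=> x; rewrite mem_rev mem_undup mem_rev. Qed.

Lemma size_id_undup (T : eqType) (t : seq T) :
  size (undup (id_of t)) = size (undup t).
Proof.
have inj : {in t &, injective (fun x => (index x (unique t)).+1)}.
  move=> x y xt yt [] /(congr1 (nth x (unique t))).
  by rewrite !nth_index ?mem_unique.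
have uq : uniq (map (fun x => (index x (unique t)).+1) (undup t)).
  rewrite map_inj_in_uniq ?undup_uniq // => x y.
  by rewrite !mem_undup; apply: inj.
rewrite -[RHS](size_map (fun x => (index x (unique t)).+1)).
apply/eqP; rewrite eqn_leq !uniq_leq_size ?undup_uniq // => n.
  by case/mapP=> x; rewrite !mem_undup => xt ->; apply: map_f.
by rewrite mem_undup => /mapP[x xt ->]; rewrite map_f ?mem_undup.
Qed.

Section Simplification.
Variable S : signature.
Local Notation S' := (simple_signature S).

Section SimpleAtom.
Variables (T : eqType) (a : atom S T).

Lemma simple_pred_subproof :
  size (pred_of a, id_of (args a)).2 == arity (pred_of a, id_of (args a)).1.
Proof. by rewrite /= size_map size_args. Qed.

Definition simple_pred : predicate S' := Atom simple_pred_subproof.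

Lemma simple_atom_subproof :
  size (simple_pred, unique (args a)).2
    == arity (simple_pred, unique (args a)).1.
Proof.
rewrite /= /args /= -/(args a) size_id_undup size_rev; apply/eqP/perm_size.
apply: uniq_perm; rewrite ?undup_uniq // => x.
by rewrite !mem_undup mem_rev.
Qed.

Definition simple_atom : atom S' T := Atom simple_atom_subproof.

End SimpleAtom.

Definition simple_db (D : {fset atom S const}) : {fset atom S' const} :=
  [fset simple_atom a | a in D].

Definition extend (X : {fset var}) (f : {ffun X -> X}) (x : var) : var :=
  if insub x is Some u then val (f u) else x.

Definition specialization (xs : seq var) (f : var -> var) : bool :=
  [forall i : 'I_(size xs),
     f (nth 0 xs i) \in nth 0 xs i :: [seq f x | x <- take i xs]].

Definition simple_atoms (f : var -> var) (A : {fset atom S var}) :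
  {fset atom S' var} := [fset simple_atom (map_atom f a) | a in A].

Lemma simple_atoms_neq0 f A : A != fset0 -> simple_atoms f A != fset0.
Proof.
case/fset0Pn=> a aA; apply/fset0Pn; exists (simple_atom (map_atom f a)).
exact: in_imfset.
Qed.

Lemma simple_tgd_by_subproof (s : tgd S) (f : var -> var) :
  let sf := (simple_atoms f (body_of s), simple_atoms f (head_of s)) in
  (sf.1 != fset0) && (sf.2 != fset0).
Proof. by have /andP[b0 h0] := valP s; rewrite /= !simple_atoms_neq0. Qed.

Definition simple_tgd_by (s : tgd S) (f : var -> var) : tgd S' :=
  Tgd (simple_tgd_by_subproof s f).

(* For a linear TGD, a is its only body atom. *)
Definition simple_tgd (s : tgd S) : {fset tgd S'} :=
  \bigcup_(a <- body_of s)
    [fset simple_tgd_by s (extend f)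
      | f in [pred f : {ffun [fset x in args a] -> [fset x in args a]}
               | specialization (args a) (extend f)]].

Definition simple (Sigma : {fset tgd S}) : {fset tgd S'} :=
  \bigcup_(s <- Sigma) simple_tgd s.

End Simplification.

(* ------------------------ Non-uniform weak-acyclicity --------------------- *)

Section WeakAcyclicity.
Variable S : signature.
Implicit Types (D : {fset atom S const}) (s : tgd S) (Sigma : {fset tgd S}).

(* Argument positions are counted from 0. *)
Definition position : Type := (predicate S * nat)%type.

(* (source, is it special?, target) *)
Definition edge : Type := (position * bool * position)%type.

Definition source (e : edge) : position := e.1.1.
Definition special (e : edge) : bool := e.1.2.
Definition target (e : edge) : position := e.2.

Definition occurs_at (x : var) (p : position) (a : atom S var) : Prop :=
  p.1 = pred_of a /\ onth (args a) p.2 = Some x.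

Inductive dg Sigma : edge -> Prop :=
| dg_normal s x a b p q of s \in Sigma & x \in frontier s
    & a \in body_of s & occurs_at x p a
    & b \in head_of s & occurs_at x q b : dg Sigma (p, false, q)
| dg_special s x z a b p q of s \in Sigma & x \in frontier s
    & a \in body_of s & occurs_at x p a
    & z \in existential s
    & b \in head_of s & occurs_at z q b : dg Sigma (p, true, q).

Definition dg_cycle Sigma (es : seq edge) : Prop :=
  (forall e, e \in es -> dg Sigma e) /\
  cycle (fun e e' => target e == source e') es.

Definition nodes (es : seq edge) : seq position :=
  map source es ++ map target es.

Definition pred_step Sigma (R P : predicate S) : Prop :=
  [/\ R \in sch Sigma, P \in sch Sigma &
      R = P \/
      exists2 s, s \in Sigma &
        R \in [fset pred_of a | a in body_of s] /\
        P \in [fset pred_of a | a in head_of s]].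

Definition pred_reach Sigma : predicate S -> predicate S -> Prop :=
  clos_trans (predicate S) (pred_step Sigma).

Definition supported D Sigma (es : seq edge) : Prop :=
  exists2 a, a \in D &
  exists2 p, p \in nodes es & pred_reach Sigma (pred_of a) p.1.

Definition weakly_acyclic D Sigma : Prop :=
  ~ exists es, [/\ dg_cycle Sigma es, has special es & supported D Sigma es].

End WeakAcyclicity.

(* Main.v *)
Require Import Defs.
From mathcomp Require Import all_boot finmap zify.
From mathcomp Require Import boolp classical_sets functions cardinality.

(* A linear trigger matches an atom only through the equality type of its      *)
(* arguments, so a specialization f of the body and the homomorphism h it      *)
(* represents have the same kernel; as invented nulls are distinct from the    *)
(* frontier terms that name them, f and the head assignment of the trigger     *)
(* also have the same kernel.  Edges of dg(simple(Sigma)) thus describe        *)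
(* exactly how terms move in the chase of Sigma.                               *)
(*                                                                             *)
(* (1) -> (3): a supported cycle with a special edge can be walked around in   *)
(* the chase forever, and each special edge yields a term that appears at a    *)
(* strictly later stage, so no stage contains the whole chase.                 *)
(*                                                                             *)
(* (3) -> (2): rank a position by the number of positions that reach it        *)
(* through a special edge; ranks are less than d and grow strictly along       *)
(* supported special edges.  By induction on k, the terms of an atom that      *)
(* occupy positions of rank at most k all lie in one argument tuple of         *)
(* generation at most k + 1 below some fact of D, where a tuple has at most    *)
(* |atoms(Sigma)| * ar^ar successors in the next generation and gives rise to  *)
(* at most |sch(Sigma)| * ar^ar atoms.                                         *)

Set Implicit Arguments.
Unset Strict Implicit.
Unset Printing Implicit Defensive.

Local Open Scope fset_scope.

(** * Equality types of tuples *)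

(** Simplification moves the equality type of an atom into its predicate, and for a linear TGD this
    type alone decides whether the body matches. The two directions are [match_trigger] (a
    simplified rule whose body predicate is met in the chase of [Sigma] comes from a trigger there)
    and [simple_tgd_ex] (each trigger is represented by some rule of [simple Sigma]).

    A finite chase excludes supported cycles with a special edge: [realize_walk] carries a term
    along any walk, and by [null_occurs] a special edge produces a null that cannot occur before a
    later stage ([finite_weakly_acyclic]).

    For the bound, the key point is that an invented null depends on the whole frontier. If it
    stands at rank at most k, [rank_special] puts every frontier term at rank below k, hence
    inductively into one tuple of an earlier generation; otherwise the terms of low rank are
    inherited ([derived_step]). Ranks stay below d, so d generations cover the chase, and
    [size_descendants] counts them. *)

Section SameKernel.
Variables (V T U : eqType) (f : V -> T) (g : V -> U) (s : seq V).
Hypothesis fg : {in s &, forall x y, (f x == f y) = (g x == g y)}.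

(** Which entries are first occurrences depends only on the equality type, so one list [r] of kept
    variables serves both images. The induction runs on [rev s] because [unique] is an [undup]
    between two reversals. *)
Lemma same_kernel_unique : exists r : seq V,
  [/\ {subset r <= s}, unique (map f s) = map f r & unique (map g s) = map g r].
Proof.
suff [r [rs fr gr]] : exists r : seq V, [/\ {subset r <= rev s},
    undup (map f (rev s)) = map f r & undup (map g (rev s)) = map g r].
  exists (rev r); split; rewrite ?map_rev.
  - by move=> x; rewrite mem_rev => /rs; rewrite mem_rev.
  - by rewrite -fr map_rev.
  - by rewrite -gr map_rev.
have fgr : {in rev s &, forall x y, (f x == f y) = (g x == g y)}.
  by move=> x y; rewrite !mem_rev; apply: fg.
elim: (rev s) fgr => [|x t IH] fgt; first by exists [::].
have [|r [rt fr gr]] := IH.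
  by move=> y z yt zt; apply: fgt; rewrite inE ?yt ?zt orbT.
have fxt : (f x \in map f t) = (g x \in map g t).
  apply/mapP/mapP => -[y yt /eqP e]; exists y => //; apply/eqP; move: e;
  by rewrite fgt // inE ?eqxx ?yt ?orbT.
rewrite /= -fxt; case: ifP => _.
  by exists r; split=> // y /rt yt; rewrite inE yt orbT.
exists (x :: r); split; rewrite /= ?fr ?gr // => y.
by rewrite !inE => /orP[->//|/rt ->]; rewrite orbT.
Qed.

Lemma same_kernel_id_of : id_of (map f s) = id_of (map g s).
Proof.
have [r [rs fr gr]] := same_kernel_unique.
rewrite /id_of fr gr -!map_comp; apply/eq_in_map => x xs /=; congr S.
rewrite /index !find_map; apply: eq_in_find => y /rs ys /=.
exact: fg.
Qed.

(** A position of a simplified atom holds the images of one and the same variable under [f] and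
    under [g]; this moves positions between rules and chase atoms. *)
Lemma same_kernel_onth i t : onth (unique (map f s)) i = Some t ->
  exists y, [/\ y \in s, t = f y & onth (unique (map g s)) i = Some (g y)].
Proof.
have [r [rs -> ->]] := same_kernel_unique; rewrite !onth_map.
case e: (onth r i) => [y|] //= [<-]; exists y; split=> //; apply: rs.
by apply/onthP; exists i.
Qed.

End SameKernel.

(** Converse of [same_kernel_id_of]: an entry is recovered from its id by looking it up in
    [unique t], so ids agree exactly where entries do. *)
Lemma id_of_inj_nth (T U : eqType) (t0 : T) (u0 : U) (t : seq T) (u : seq U) :
  id_of t = id_of u ->
  forall i j, i < size t -> j < size t ->
    (nth t0 t i == nth t0 t j) = (nth u0 u i == nth u0 u j).
Proof.
move=> e; have sz : size t = size u.
  by rewrite -(size_map (fun x => (index x (unique t)).+1)) -[LHS]/(size (id_of t)) e size_map.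
have H (A : eqType) (a0 : A) (s : seq A) i j : i < size s -> j < size s ->
    (nth a0 s i == nth a0 s j) = (nth 0 (id_of s) i == nth 0 (id_of s) j).
  move=> li lj; rewrite !(nth_map a0) // eqSS.
  apply/eqP/eqP => [->//|/(congr1 (nth a0 (unique s)))].
  by rewrite !nth_index // mem_unique mem_nth.
by move=> i j li lj; rewrite (H _ t0) // e -(H _ u0) // -sz.
Qed.

(** * Terms of chase instances *)

Section Chase.
Variable S : signature.
Implicit Types (D : {fset atom S const}) (s : tgd S) (Sigma : {fset tgd S}).
Implicit Types (I J X : set (atom S term)) (h : var -> term).

Lemma atom_inj T (a b : atom S T) : pred_of a = pred_of b -> args a = args b -> a = b.
Proof.
move=> e1 e2; apply: val_inj; move: e1 e2; rewrite /pred_of /args /=.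
by case: (atom_val a) (atom_val b) => [? ?] [? ?] /= -> ->.
Qed.

Lemma map_atom_in (T : eqType) U (f g : T -> U) (a : atom S T) :
  {in args a, f =1 g} -> map_atom f a = map_atom g a.
Proof. by move=> fg; apply: atom_inj => //; apply/eq_in_map. Qed.

Lemma mem_vars (A : {fset atom S var}) x :
  reflect (exists2 a, a \in A & x \in args a) (x \in vars A).
Proof.
apply: (iffP (bigfcupP _ _ _ _)) => [[a]|[a aA xa]].
  by rewrite andbT => aA; rewrite in_fset => xa; exists a.
by exists a; rewrite ?aA // in_fset.
Qed.

Lemma frontier_body s x : x \in frontier s -> x \in vars (body_of s).
Proof. by rewrite in_fsetI => /andP[]. Qed.

Lemma frontier_head s x : x \in frontier s -> x \in vars (head_of s).
Proof. by rewrite in_fsetI => /andP[]. Qed.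

Definition mu s h x : term :=
  if x \in frontier s then h x else inr (null_of s h x).

Lemma resultE s h a : result s h a <-> exists2 b, b \in head_of s & a = map_atom (mu s h) b.
Proof. by split=> [[b /= bs <-]|[b bs ->]]; exists b. Qed.

Lemma restrict_eq (A : {fset var}) h h' : {in A, h =1 h'} -> Defs.restrict h A = Defs.restrict h' A.
Proof.
move=> hh; rewrite /Defs.restrict.
suff -> : (fun y : A => h (val y)) = (fun y : A => h' (val y)) by [].
by apply/funext => y; apply: hh; apply: valP.
Qed.

Lemma null_of_eq s h h' x : {in frontier s, h =1 h'} -> null_of s h x = null_of s h' x.
Proof. by move=> hh; rewrite /null_of (restrict_eq hh). Qed.

Lemma null_of_inj s h x s' h' x' : null_of s h x = null_of s' h' x' ->
  [/\ x = x', s = s' & {in frontier s, h =1 h'}].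
Proof.
move=> /(pcan_inj choice.pickleK) e.
have ex : x = x' := congr1 (fun z => z.1.1) e.
have es : s = s' := congr1 (fun z => z.1.2) e.
have em : Defs.restrict h (frontier s) = Defs.restrict h' (frontier s') := congr1 snd e.
rewrite {}ex; subst s'; split=> // y ys.
have := congr1 (fun m : {fmap var -> term} => m.[? y]%fmap) em.
by rewrite /Defs.restrict !in_fnd !ffunE /= => -[].
Qed.

Lemma mu_eq s h h' : {in frontier s, h =1 h'} -> mu s h =1 mu s h'.
Proof. by move=> hh x; rewrite /mu; case: ifP => [/hh//|_]; rewrite (null_of_eq _ hh). Qed.

Lemma result_eq s h h' : {in frontier s, h =1 h'} -> result s h = result s h'.
Proof.
move=> hh; apply/seteqP; split=> a /resultE [b bs ->]; apply/resultE; exists b => //.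
  exact/map_atom_in/(in1W (mu_eq hh)).
by apply/esym/map_atom_in/(in1W (mu_eq hh)).
Qed.

End Chase.

(** * Derivations and closure of their limits *)

Section Derivations.
Variable S : signature.
Implicit Types (D : {fset atom S const}) (s : tgd S) (Sigma : {fset tgd S}).
Implicit Types (I J X : set (atom S term)) (h : var -> term).
Implicit Types u : nat -> set (atom S term).

Local Open Scope classical_set_scope.

(** Idle steps are allowed, so that a finite derivation becomes an infinite sequence by repeating
    its last instance. *)
Definition weak_derivation D Sigma u : Prop :=
  u 0 = instance_of D /\
  forall i, u i.+1 = u i \/ chase_step Sigma (u i) (u i.+1).

Definition closed_under Sigma I : Prop :=
  forall s h, trigger Sigma I s h -> result s h `<=` I.

Lemma weak_derivation_mono D Sigma u : weak_derivation D Sigma u ->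
  forall i j, i <= j -> u i `<=` u j.
Proof.
move=> [_ st] i j; elim: j => [|j IH]; first by rewrite leqn0 => /eqP ->.
rewrite leq_eqVlt ltnS => /predU1P[->//|/IH ij] a /ij aj.
by case: (st j) => [->//|[s [h [_ ->]]]]; left.
Qed.

Lemma chase_result_derivation D Sigma X :
  (forall s, s \in Sigma -> linear s) -> chase_result D Sigma X ->
  exists u, [/\ weak_derivation D Sigma u, X = \bigcup_i u i & closed_under Sigma X].
Proof.
move=> lin [[u [n [[u0 st stop] ->]]]|[u [[u0 st fair] ->]]].
  have wd : weak_derivation D Sigma (fun i => u (minn i n)).
    split=> [|i]; first by rewrite min0n.
    have [ni|ni] := boolP (i < n).
      by right; rewrite (minn_idPl ni) (minn_idPl (ltnW ni)); apply: st.
    by left; rewrite -leqNgt in ni; rewrite !(minn_idPr _) // leqW.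
  have eU : \bigcup_(i in [set i | i <= n]) u i = u n.
    apply/seteqP; split=> [a [i /= ni ai]|a an]; last by exists n => /=.
    have := weak_derivation_mono wd ni; rewrite minnn (minn_idPl ni); exact.
  exists (fun i => u (minn i n)); split=> //.
    rewrite eU; apply/seteqP; split=> [a an|a [i _]].
      by exists n => //=; rewrite minnn.
    have := weak_derivation_mono wd (leq_maxl i n) => /(_ a) /[apply].
    by rewrite (minn_idPr (leq_maxr i n)).
  rewrite eU => s h tr; apply: contrapT => nsub.
  by apply: (stop s h).
have wd : weak_derivation D Sigma u by split=> // i; right.
exists u; split=> // s h [sS hb].
(* The single body atom enters at some finite stage, from which the trigger persists; being inactive
   at such a stage then means that its result is already present. *)
have [a ba] := lin s sS.
have [|i _ ai] := hb a; first by rewrite ba in_fset1.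
have tr j : i <= j -> trigger Sigma (u j) s h.
  move=> ij; split=> // b; rewrite ba in_fset1 => /eqP ->.
  exact: weak_derivation_mono wd _ _ ij _ ai.
case: (pselect (active Sigma (u i) s h)) => [act|nact].
  have [j ij nact] := fair _ _ _ act.
  move=> b rb; exists j => //; apply: contrapT => nb; apply: nact.
  by split=> [|/(_ b rb)//]; apply: tr; apply: ltnW.
move=> b rb; exists i => //; apply: contrapT => nb; apply: nact.
by split=> [|/(_ b rb)//]; apply: tr.
Qed.

(** * Existence of fair derivations *)

(** Restricting [h] to the body variables leaves finite data, hence a natural number. *)
Definition trigger_code s h : nat :=
  choice.pickle (s, Defs.restrict h (vars (body_of s))).

Lemma trigger_code_inj s h s' h' : trigger_code s h = trigger_code s' h' ->
  s = s' /\ {in vars (body_of s), h =1 h'}.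
Proof.
move=> /(pcan_inj choice.pickleK) e.
have es : s = s' := congr1 fst e.
have em : Defs.restrict h (vars (body_of s)) =
          Defs.restrict h' (vars (body_of s')) := congr1 snd e.
subst s'; split=> // y ys.
have := congr1 (fun m : {fmap var -> term} => m.[? y]%fmap) em.
by rewrite /Defs.restrict !in_fnd !ffunE /= => -[].
Qed.

(* Firing the active trigger of least code is fair: a trigger that stays      *)
(* active would be preceded by infinitely many distinct triggers of smaller   *)
(* code.                                                                      *)
Definition least_step Sigma I J : Prop :=
  exists s h, [/\ active Sigma I s h, J = I `|` result s h &
    forall s' h', active Sigma I s' h' -> trigger_code s h <= trigger_code s' h'].

Lemma least_step_ex Sigma I :
  (exists s h, active Sigma I s h) -> exists J, least_step Sigma I J.
Proof.
move=> [s0 [h0 act0]].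
pose P n := `[< exists s h, active Sigma I s h /\ trigger_code s h = n >].
have exP : exists n, P n by exists (trigger_code s0 h0); apply/asboolP; exists s0, h0.
case: (ex_minnP exP) => n /asboolP[s [h [act <-]]] least.
exists (I `|` result s h), s, h; split=> // s' h' act'.
by apply: least; apply/asboolP; exists s', h'.
Qed.

Lemma least_steps_fair D Sigma u : u 0 = instance_of D ->
  (forall i, least_step Sigma (u i) (u i.+1)) -> infinite_derivation D Sigma u.
Proof.
move=> u0 st.
have wd : weak_derivation D Sigma u.
  by split=> // i; right; have [s [h [? ? _]]] := st i; exists s, h.
split=> //; first by move=> i; have [s [h [? ? _]]] := st i; exists s, h.
move=> i s h act; apply: contrapT => nfair.
have act_after j : i <= j -> active Sigma (u j) s h.
  rewrite leq_eqVlt => /predU1P[<-//|ij].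
  by apply: contrapT => nact; apply: nfair; exists j.
have /choice[sg] : forall j, exists sh : tgd S * (var -> term),
    [/\ active Sigma (u j) sh.1 sh.2, u j.+1 = u j `|` result sh.1 sh.2 &
    forall s' h', active Sigma (u j) s' h' -> trigger_code sh.1 sh.2 <= trigger_code s' h'].
  by move=> j; have [s' [h' H]] := st j; exists (s', h').
move=> sgP; pose c j := trigger_code (sg j).1 (sg j).2.
have cinj : injective c.
  suff W j j' : j < j' -> c j <> c j'.
    move=> j j' e; case: (ltngtP j j') => // /W; first by move/(_ e).
    by move/(_ (esym e)).
  move=> jj' /trigger_code_inj[es eh]; have [act1 _ _] := sgP j'.
  have [_ e _] := sgP j; case: act1 => _; apply; rewrite -es.
  rewrite -(@result_eq _ _ (sg j).2); last first.
    by move=> x /frontier_body; apply: eh.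
  move=> a ra; apply: weak_derivation_mono wd _ _ jj' _ _.
  by rewrite e; right.
have bound j : i <= j -> c j < (trigger_code s h).+1.
  by move=> ij; have [_ _ ] := sgP j; rewrite ltnS; apply; apply: act_after.
(* Pigeonhole: with T the code of the neglected trigger, the T + 2 steps from [i] on fire triggers
   with distinct codes, all at most T. *)
have /negP[] : ~~ ((trigger_code s h).+2 <= (trigger_code s h).+1) by rewrite ltnn.
rewrite -[leqLHS](size_iota i) -(size_map c) -[leqRHS](size_iota 0).
apply: uniq_leq_size.
  by rewrite map_inj_uniq // iota_uniq.
move=> n /mapP[j]; rewrite mem_iota => /andP[ij _] ->.
by rewrite mem_iota bound.
Qed.

Lemma chase_result_ex D Sigma : exists X, chase_result D Sigma X.
Proof.
have /choice[nxt nxtP] : forall I, exists J,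
    (exists s h, active Sigma I s h) -> least_step Sigma I J.
  move=> I; case: (pselect (exists s h, active Sigma I s h)) => [act|nact].
    by have [J IJ] := least_step_ex act; exists J.
  by exists I => /nact.
pose u i := iter i nxt (instance_of D).
case: (pselect (exists n, forall s h, ~ active Sigma (u n) s h)) => [[n0 stop]|go].
  pose P n := `[< forall s h, ~ active Sigma (u n) s h >].
  have exP : exists n, P n by exists n0; apply/asboolP.
  case: (ex_minnP exP) => n /asboolP stopn least.
  exists (\bigcup_(i in [set i | i <= n]) u i); left; exists u, n; split=> //.
  split=> // i ni; suff /nxtP[s [h [? ? _]]] : exists s h, active Sigma (u i) s h.
    by exists s, h.
  apply: contrapT => nact; suff /least : P i by rewrite leqNgt ni.
  by apply/asboolP => s h act; apply: nact; exists s, h.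
exists (\bigcup_i u i); right; exists u; split=> //.
apply: least_steps_fair => // i; apply: nxtP.
apply: contrapT => nact; apply: go; exists i => s h act.
by apply: nact; exists s, h.
Qed.

(** [chase] picks a result by choice, so it has the properties common to all results as soon as one
    exists. *)
Lemma chase_derivation D Sigma : (forall s, s \in Sigma -> linear s) ->
  exists u, [/\ weak_derivation D Sigma u, chase D Sigma = \bigcup_i u i &
                closed_under Sigma (chase D Sigma)].
Proof.
move=> lin; apply: chase_result_derivation => //.
exact: (xgetPex set0 (chase_result_ex D Sigma)).
Qed.

(** * Freshness of nulls *)

Definition occurs (t : term) I : Prop := exists2 a, I a & t \in args a.

Lemma occurs_hom I s h x : homomorphism h (body_of s) I ->
  x \in vars (body_of s) -> occurs (h x) I.
Proof. by move=> hb /mem_vars[a /hb aI xa]; exists (map_atom h a) => //; apply: map_f. Qed.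

(** The database has no nulls, so this null is either copied from an earlier instance or invented by
    a trigger for [s] that agrees with [h] on the frontier; the body image of that trigger was there
    before the step. *)
Lemma null_occurs D Sigma u s h y m : weak_derivation D Sigma u ->
  occurs (inr (null_of s h y)) (u m) ->
  forall x, x \in frontier s -> exists2 m', m' < m & occurs (h x) (u m').
Proof.
move=> [u0 st]; elim: m => [|m IH] occ x xs.
  by case: occ => a; rewrite u0 => -[b _ <-] /mapP[].
suff [[m' mm' ?]|?] : (exists2 m', m' < m & occurs (h x) (u m')) \/ occurs (h x) (u m).
  - by exists m' => //; apply: ltnW.
  - by exists m.
have old : occurs (inr (null_of s h y)) (u m) ->
    (exists2 m', m' < m & occurs (h x) (u m')) \/ occurs (h x) (u m).
  by move=> /IH/(_ _ xs); left.
case: (st m) => [e|[s2 [h2 [[[_ hb] _] e]]]]; first by apply: old; rewrite -e.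
case: occ => a; rewrite e => -[am|/resultE[b bs ->]] ta; first by apply: old; exists a.
case/mapP: ta => z zb; rewrite /mu; case: ifP => [zs ez|_ [] ez].
  by apply: old; rewrite ez; apply: occurs_hom hb (frontier_body zs).
have [_ es eh] := null_of_inj ez; subst s2; right; rewrite eh //.
exact: occurs_hom hb (frontier_body xs).
Qed.

(** Otherwise the null would belong to its own name and, by [null_occurs], occur at ever earlier
    stages. *)
Lemma null_neq_frontier D Sigma u s h x y m : weak_derivation D Sigma u ->
  homomorphism h (body_of s) (u m) -> x \in frontier s ->
  h x <> inr (null_of s h y).
Proof.
move=> wd hb xs e.
have : occurs (h x) (u m) by apply: occurs_hom hb (frontier_body xs).
elim/ltn_ind: m {hb} => m IH occ; rewrite e in occ.
by have [m' m'm] := null_occurs wd occ xs; apply: IH.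
Qed.
End Derivations.

(** * Simplification *)

Section Simplification.
Variable S : signature.
Implicit Types (s : tgd S) (Sigma : {fset tgd S}) (h : var -> term).
Implicit Types (f : var -> var) (a b : atom S var).

Definition same_kernel (T U : eqType) (A : {fset var}) (f : var -> T) (g : var -> U) :=
  {in A &, forall x y, (f x == f y) = (g x == g y)}.

Lemma simple_pred_same_kernel (T U : eqType) (A : {fset atom S var})
    (f : var -> T) (g : var -> U) b :
  same_kernel (vars A) f g -> b \in A ->
  simple_pred (map_atom f b) = simple_pred (map_atom g b).
Proof.
move=> fg bA; apply: val_inj; congr pair; apply: same_kernel_id_of => x y xb yb.
by apply: fg; apply/mem_vars; exists b.
Qed.

Lemma onth_same_kernel (T U : eqType) (A : {fset atom S var})
    (f : var -> T) (g : var -> U) b i t :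
  same_kernel (vars A) f g -> b \in A ->
  onth (unique (args (map_atom f b))) i = Some t ->
  exists x, [/\ x \in args b, t = f x &
                onth (unique (args (map_atom g b))) i = Some (g x)].
Proof.
move=> fg bA; apply: same_kernel_onth => x y xb yb.
by apply: fg; apply/mem_vars; exists b.
Qed.

Lemma simple_pred_inj (T U : eqType) (alpha : atom S T) (beta : atom S U) :
  simple_pred alpha = simple_pred beta ->
  pred_of alpha = pred_of beta /\ id_of (args alpha) = id_of (args beta).
Proof. by move=> e; have [] := congr1 val e. Qed.

(** [h] sends a variable to the entry of [alpha] at its first occurrence in [a]; equal ids make this
    consistent at the repeated occurrences. *)
Lemma match_simple_pred (T : eqType) f a (alpha : atom S T) :
  simple_pred (map_atom f a) = simple_pred alpha ->
  exists h : var -> T, map_atom h a = alpha /\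
    {in args a &, forall x y, (f x == f y) = (h x == h y)}.
Proof.
move=> /simple_pred_inj[ep eid].
have sz : size (args a) = size (args alpha) by rewrite !size_args -ep.
have [t0 _] : exists t0 : T, True.
  have := arity_gt0 (pred_of alpha); rewrite -size_args.
  by case: (args alpha) => // t0 _ _; exists t0.
have K := id_of_inj_nth 0 t0 eid.
rewrite size_map in K.
have Kn i j : i < size (args a) -> j < size (args a) ->
    (f (nth 0 (args a) i) == f (nth 0 (args a) j)) =
    (nth t0 (args alpha) i == nth t0 (args alpha) j).
  by move=> li lj; rewrite -K // !(nth_map 0).
exists (fun x => nth t0 (args alpha) (index x (args a))); split.
  apply: atom_inj => //=; apply: (@eq_from_nth _ t0).
    by rewrite size_map.
  move=> i; rewrite size_map => li; rewrite (nth_map 0) //; apply/eqP.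
  have ia : nth 0 (args a) i \in args a by apply: mem_nth.
  by rewrite -Kn ?index_mem // nth_index.
by move=> x y xa ya /=; rewrite -Kn ?index_mem // !nth_index.
Qed.

(** The trait of a specialization that matters for heads: existential variables are fixed and never
    merged with images of body variables. *)
Definition body_map s f : Prop :=
  (forall x, x \in vars (body_of s) -> f x \in vars (body_of s)) /\
  (forall x, x \notin vars (body_of s) -> f x = x).

Lemma vars1 a x : (x \in vars [fset a]) = (x \in args a).
Proof.
apply/mem_vars/idP => [[b]|xa]; first by rewrite in_fset1 => /eqP ->.
by exists a; rewrite ?in_fset1.
Qed.

Lemma body_map_extend s a (f : {ffun [fset x in args a] -> [fset x in args a]}) :
  body_of s = [fset a] -> body_map s (extend f).
Proof.
move=> ba; split=> x; rewrite ba vars1 /extend; case: insubP => /= [v|].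
- by move=> _ _ _; have := valP (f v); rewrite vars1 in_fset.
- by rewrite in_fset => /negbTE ->.
- by move=> + _; rewrite in_fset => ->.
- by [].
Qed.

Lemma simpleP Sigma (s' : tgd (simple_signature S)) :
  (forall s, s \in Sigma -> linear s) -> s' \in simple Sigma ->
  exists s f, [/\ s \in Sigma, body_map s f & s' = simple_tgd_by s f].
Proof.
move=> lin /bigfcupP[s]; rewrite andbT => sS; have [a ba] := lin s sS.
move=> /bigfcupP[b]; rewrite andbT ba in_fset1 => /eqP -> /imfsetP[f /= _ ->].
by exists s, (extend f); split=> //; apply: body_map_extend.
Qed.

Lemma simple_tgd_ex (T : eqType) Sigma s (h : var -> T) :
  (forall s, s \in Sigma -> linear s) -> s \in Sigma ->
  exists f, [/\ body_map s f, same_kernel (vars (body_of s)) f h &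
                simple_tgd_by s f \in simple Sigma].
Proof.
move=> lin sS; have [a ba] := lin s sS.
(* [f0] picks the first body variable with the same value under [h], so it has the kernel of [h]. *)
pose xs := args a; pose f0 x := nth 0 xs (index (h x) (map h xs)).
have hf0 x : x \in xs -> h (f0 x) = h x.
  move=> xx; have hx : h x \in map h xs by apply: map_f.
  by rewrite -(nth_map _ (h 0)) ?nth_index // -(size_map h) index_mem.
have f0xs x : x \in xs -> f0 x \in [fset x in xs].
  move=> xx; rewrite in_fset mem_nth // -(size_map h) index_mem; exact: map_f.
pose f := [ffun v : [fset x in xs] =>
             insubd v (f0 (val v))] : {ffun [fset x in xs] -> [fset x in xs]}.
have ef x : x \in xs -> extend f x = f0 x.
  move=> xx; rewrite /extend insubT ?in_fset // => xx'.
  by rewrite ffunE /= insubdK //= f0xs.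
have ker x y : x \in xs -> y \in xs -> (f0 x == f0 y) = (h x == h y).
  move=> xx yx; apply/eqP/eqP => [/(congr1 h)|]; first by rewrite !hf0.
  by rewrite /f0 => ->.
exists (extend f); split; first exact: body_map_extend.
  by move=> x y; rewrite ba !vars1 => xx yx; rewrite !ef // ker.
apply/bigfcupP; exists s; rewrite ?sS //.
apply/bigfcupP; exists a; rewrite ?ba ?in_fset1 ?eqxx //.
apply/imfsetP; exists f => //=; apply/forallP => -[i li] /=.
set x := nth 0 _ i; have xx : x \in xs by apply: mem_nth.
(* If [x] is not its own representative, the representative stands strictly earlier in the tuple and
   is fixed by [f0], as a specialization demands. *)
rewrite ef // in_cons; case: eqP => //= ne.
set j := index (h x) (map h xs).
have ji : j <= i.
  by rewrite leqNgt; apply/negP => /(before_find (h 0)) /=; rewrite (nth_map 0) // eqxx.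
have {}ji : j < i.
  by rewrite ltn_neqAle ji andbT; apply: contra_notN ne => /eqP e; rewrite /f0 -/j e.
have jx : f0 x \in take i xs.
  by apply/(nthP 0); exists j; rewrite ?size_takel ?nth_take // ltnW.
apply/mapP; exists (f0 x) => //; rewrite ef ?(mem_take jx) //.
by apply/esym/eqP; rewrite ker ?hf0 ?(mem_take jx).
Qed.

Lemma mem_simple_atoms f (A : {fset atom S var}) (a' : atom (simple_signature S) var) :
  a' \in simple_atoms f A <-> exists2 a, a \in A & a' = simple_atom (map_atom f a).
Proof.
split=> [/imfsetP[a aA ->]|[a aA ->]]; first by exists a.
by apply/imfsetP; exists a.
Qed.

Lemma vars_simple_atoms f (A : {fset atom S var}) x :
  x \in vars (simple_atoms f A) <-> exists2 y, y \in vars A & x = f y.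
Proof.
split=> [/mem_vars[_ /mem_simple_atoms[a aA ->]]|[y /mem_vars[a aA ya] ->]].
  rewrite /args /= mem_unique => /mapP[y ya ->].
  by exists y => //; apply/mem_vars; exists a.
apply/mem_vars; exists (simple_atom (map_atom f a)).
  by apply/mem_simple_atoms; exists a.
by rewrite /args /= mem_unique; apply: map_f.
Qed.

Lemma not_frontier_body s x :
  x \in vars (head_of s) -> x \notin frontier s -> x \notin vars (body_of s).
Proof. by rewrite in_fsetI => ->; rewrite andbT. Qed.

Lemma frontier_simple s f x : body_map s f ->
  x \in frontier (simple_tgd_by s f) <-> exists2 y, y \in frontier s & x = f y.
Proof.
move=> [fin fout]; split=> [|[y ys ->]].
  rewrite in_fsetI => /andP[/vars_simple_atoms[y yb ->] /vars_simple_atoms[z zh e]].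
  exists z => //; apply: contraT => zs.
  by have := not_frontier_body zh zs; rewrite -(fout z) -?e ?fin ?not_frontier_body.
rewrite in_fsetI; apply/andP; split; apply/vars_simple_atoms; exists y => //.
  exact: frontier_body.
exact: frontier_head.
Qed.

Lemma existential_simple s f x : body_map s f ->
  (x \in existential (simple_tgd_by s f)) = (x \in existential s).
Proof.
move=> [fin fout]; rewrite !in_fsetD; apply/andP/andP => -[nb].
  move=> /vars_simple_atoms[y yh e].
  have nyb : y \notin vars (body_of s).
    by apply: contra nb => yb; apply/vars_simple_atoms; exists y.
  by rewrite e fout.
move=> xh; split; last by apply/vars_simple_atoms; exists x; rewrite ?fout.
apply: contra nb => /vars_simple_atoms[y yb ->]; exact: fin.
Qed.

(** On the frontier the body kernels apply. An invented null differs from frontier terms by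
    freshness and from its siblings by the variable in its name, just as [f] keeps existential
    variables apart. *)
Lemma head_same_kernel s f h : body_map s f -> same_kernel (vars (body_of s)) f h ->
  (forall x y, x \in frontier s -> h x <> inr (null_of s h y)) ->
  same_kernel (vars (head_of s)) f (mu s h).
Proof.
move=> [fin fout] fh fresh x y xh yh; rewrite /mu.
have neq v w : v \in frontier s -> w \in vars (head_of s) -> w \notin frontier s ->
    (f v == f w) = false.
  move=> vs wh ws; have wb := not_frontier_body wh ws.
  apply: contraNF (wb) => /eqP; rewrite [f w]fout // => <-.
  exact/fin/frontier_body.
have [xs|xs] := boolP (x \in frontier s); have [ys|ys] := boolP (y \in frontier s).
- by apply: fh; apply: frontier_body.
- by rewrite neq //; apply/esym/eqP/fresh.
- rewrite eq_sym neq //; apply/esym/eqP => /esym; exact: fresh.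
rewrite !fout ?not_frontier_body //; apply/eqP/eqP => [->//|[]].
by case/null_of_inj.
Qed.
End Simplification.

(** * Walks in the dependency graph *)

Section Walks.
Variable S : signature.
Implicit Types (Sigma : {fset tgd S}) (p q : position S) (es : seq (edge S)).

(** Unlike the cyclic lists of [dg_cycle], walks have named endpoints and concatenate; a cycle
    becomes a closed walk at any chosen node. *)
Fixpoint walk Sigma p es q : Prop :=
  if es is e :: es' then [/\ dg Sigma e, source e = p & walk Sigma (target e) es' q]
  else p = q.

Lemma walk_cat Sigma p es q es' r :
  walk Sigma p es q -> walk Sigma q es' r -> walk Sigma p (es ++ es') r.
Proof.
elim: es p => [|e es IH] p /=; first by move=> ->.
by move=> [? ? w] w'; split=> //; apply: IH.
Qed.

Let link (e e' : edge S) := target e == source e'.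

Lemma path_walk Sigma e es e0 : dg Sigma e -> (forall e', e' \in es -> dg Sigma e') ->
  path link e (rcons es e0) -> walk Sigma (source e) (e :: es) (source e0).
Proof.
elim: es e => [|e1 es IH] e dge dges /=.
  by rewrite andbT => /eqP <-; split.
move=> /andP[/eqP ee1 pe]; split=> //; rewrite ee1; apply: IH => //.
  by apply: dges; rewrite mem_head.
by move=> e' e'es; apply: dges; rewrite in_cons e'es orbT.
Qed.

Lemma walk_path Sigma e es e0 :
  walk Sigma (target e) es (source e0) -> path link e (rcons es e0).
Proof.
elim: es e => [|e1 es IH] e /=; first by rewrite /link => ->; rewrite eqxx.
by move=> [_ e1e w]; rewrite {1}/link e1e eqxx IH.
Qed.

Lemma walk_dg Sigma p es q : walk Sigma p es q -> forall e, e \in es -> dg Sigma e.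
Proof.
elim: es p => // e es IH p [dge _ w] e'.
by rewrite in_cons => /orP[/eqP ->//|/(IH _ w)].
Qed.

Lemma dg_source_arity Sigma e : dg Sigma e -> (source e).2 < arity (source e).1.
Proof.
by case=> [s x a b p q _ _ _ [e1 e2]|s x z a b p q _ _ _ [e1 e2]] *;
  rewrite /source /= e1 -size_args -onthTE e2.
Qed.

Lemma walk_cycle Sigma p es : walk Sigma p es p -> dg_cycle Sigma es.
Proof.
move=> w; split; first exact: walk_dg w.
case: es w => [|e es] //= [_ ep w].
by apply: walk_path; rewrite ep; apply: w.
Qed.

Lemma cycle_source_walk Sigma es e : dg_cycle Sigma es -> e \in es ->
  exists es', walk Sigma (source e) es' (source e) /\ has (@special _) es' = has (@special _) es.
Proof.
move=> [dges cyc] ees; have [i es' erot] := rot_to ees.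
exists (e :: es'); split; last by rewrite -erot has_rot.
have mem e' : e' \in e :: es' -> dg Sigma e' by rewrite -erot mem_rot; apply: dges.
apply: path_walk; first by apply: mem; rewrite mem_head.
  by move=> e' e'es; apply: mem; rewrite in_cons e'es orbT.
by move: cyc; rewrite -(rot_cycle i) erot.
Qed.

Lemma cycle_node_walk Sigma es p : dg_cycle Sigma es -> p \in nodes es ->
  exists es', walk Sigma p es' p /\ has (@special _) es' = has (@special _) es.
Proof.
move=> cyc; rewrite mem_cat => /orP[] /mapP[e ees ->].
  exact: cycle_source_walk.
suff [e' e'es ->] : exists2 e', e' \in es & target e = source e'.
  exact: cycle_source_walk.
have [i es' erot] := rot_to ees; move: cyc => [_].
rewrite -(rot_cycle i) erot /= => pth.
have mem e' : e' \in rcons es' e -> e' \in es.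
  by rewrite mem_rcons -erot mem_rot.
(* The edge following [e] is [head e es'], which is [e] itself when the cycle is a loop. *)
rewrite headI /= in pth mem; case/andP: pth => /eqP ee' _.
by exists (head e es') => //; apply: mem; rewrite mem_head.
Qed.
End Walks.

(** * Edges of the dependency graph of the simplification *)

Section SimpleEdges.
Variable S : signature.
Implicit Types (s : tgd S) (Sigma : {fset tgd S}) (h : var -> term).
Implicit Types (f : var -> var) (a b : atom S var).

(** Puts normal and special edges into one form over the original TGD: the kind of the edge is read
    off the head variable [y], and on a normal edge [x] and [y] need only be identified by [f]. *)
Lemma simple_edgeP Sigma (e : edge (simple_signature S)) :
  (forall s, s \in Sigma -> linear s) -> dg (simple Sigma) e ->
  exists s f a b x y,
  [/\ [/\ s \in Sigma, body_map s f & body_of s = [fset a]],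
      [/\ x \in frontier s, (source e).1 = simple_pred (map_atom f a) &
          onth (unique (args (map_atom f a))) (source e).2 = Some (f x)],
      [/\ b \in head_of s, y \in args b, (target e).1 = simple_pred (map_atom f b) &
          onth (unique (args (map_atom f b))) (target e).2 = Some (f y)],
      special e = (y \notin frontier s) & (y \in frontier s -> f y = f x)].
Proof.
move=> lin; case.
  move=> s' x' a' b' p q /(simpleP lin)[s [f [sS sf ->]]].
  move=> /(frontier_simple _ sf)[x xs ->] /mem_simple_atoms[a ab ->] [p1 p2].
  move=> /mem_simple_atoms[b bh ->] [q1 q2].
  have [a0 ba] := lin s sS; move: ab; rewrite ba in_fset1 => /eqP ea; subst a0.
  have /mapP[y yb exy] : f x \in map f (args b).
    by rewrite -mem_unique; apply/onthP; exists q.2.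
  have ys : y \in frontier s.
    have yh : y \in vars (head_of s) by apply/mem_vars; exists b.
    (* Outside the frontier [y] would be fixed by [f] and lie outside the body, whereas [f y = f x]
       is a body variable. *)
    apply: contraT => ys; have yb' := not_frontier_body yh ys.
    by move: (yb'); rewrite -(sf.2 _ yb') -exy sf.1 // frontier_body.
  exists s, f, a, b, x, y; split=> //; last by rewrite ys.
  by split=> //; rewrite -exy.
move=> s' x' z' a' b' p q /(simpleP lin)[s [f [sS sf ->]]].
move=> /(frontier_simple _ sf)[x xs ->] /mem_simple_atoms[a ab ->] [p1 p2].
rewrite existential_simple // in_fsetD => /andP[zb zh].
move=> /mem_simple_atoms[b bh ->] [q1 q2].
have [a0 ba] := lin s sS; move: ab; rewrite ba in_fset1 => /eqP ea; subst a0.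
have /mapP[y yb ezy] : z' \in map f (args b).
  by rewrite -mem_unique; apply/onthP; exists q.2.
have yb' : y \notin vars (body_of s).
  by apply: contra zb => /(sf.1); rewrite -ezy.
have ys : y \notin frontier s by apply: contra yb' => /frontier_body.
exists s, f, a, b, x, y; split=> //; last by rewrite (negbTE ys).
by split=> //; rewrite -ezy.
Qed.

Lemma simple_edge Sigma s f a b x y i j :
  body_map s f -> simple_tgd_by s f \in simple Sigma ->
  a \in body_of s -> x \in frontier s ->
  onth (unique (args (map_atom f a))) i = Some (f x) ->
  b \in head_of s -> y \in args b -> (y \in frontier s -> f y = f x) ->
  onth (unique (args (map_atom f b))) j = Some (f y) ->
  dg (simple Sigma) ((simple_pred (map_atom f a), i), y \notin frontier s,
                     (simple_pred (map_atom f b), j)).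
Proof.
move=> sf sS ab xs oi bh yb yx oj.
have xs' : f x \in frontier (simple_tgd_by s f) by apply/frontier_simple => //; exists x.
have a' : simple_atom (map_atom f a) \in body_of (simple_tgd_by s f).
  by apply/mem_simple_atoms; exists a.
have b' : simple_atom (map_atom f b) \in head_of (simple_tgd_by s f).
  by apply/mem_simple_atoms; exists b.
case: (boolP (y \in frontier s)) => ys /=.
  by apply: (dg_normal sS xs' a' _ b'); split=> //=; rewrite -yx.
have yh : y \in vars (head_of s) by apply/mem_vars; exists b.
have yb' := not_frontier_body yh ys.
have ze : y \in existential (simple_tgd_by s f).
  by rewrite existential_simple // in_fsetD yb' yh.
by apply: (dg_special sS xs' a' _ ze b'); split=> //=; rewrite -(sf.2 _ yb').
Qed.
End SimpleEdges.

(** * A finite chase forces weak acyclicity *)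

Section Realization.
Variables (S : signature) (D : {fset atom S const}) (Sigma : {fset tgd S}).
Variable u : nat -> set (atom S term).
Hypothesis lin : forall s, s \in Sigma -> linear s.
Hypothesis wd : weak_derivation D Sigma u.
Let X : set (atom S term) := (\bigcup_i u i)%classic.
Hypothesis Xclosed : closed_under Sigma X.
Implicit Types (s : tgd S) (h : var -> term) (f : var -> var) (a b : atom S var).

Definition term_at (t : term) (p : position (simple_signature S)) (alpha : atom S term) :=
  p.1 = simple_pred alpha /\ onth (unique (args alpha)) p.2 = Some t.

Definition newer (n : nat) (t : term) := forall m, m < n -> ~ occurs t (u m).

Lemma match_trigger s f a (alpha : atom S term) : s \in Sigma -> body_map s f ->
  body_of s = [fset a] -> simple_pred (map_atom f a) = simple_pred alpha -> X alpha ->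
  exists h, [/\ map_atom h a = alpha, same_kernel (vars (body_of s)) f h,
    same_kernel (vars (head_of s)) f (mu s h) & result s h `<=` X]%classic.
Proof.
move=> sS sf ba eq_pred Xa; have [h [ha hk]] := match_simple_pred eq_pred.
have hb I : I alpha -> homomorphism h (body_of s) I.
  by move=> Ia b; rewrite ba in_fset1 => /eqP ->; rewrite ha.
have bk : same_kernel (vars (body_of s)) f h.
  by move=> x y; rewrite ba !vars1; apply: hk.
exists h; split=> //.
  apply: head_same_kernel => // x y xs; have [i _ /hb hi] := Xa.
  exact: null_neq_frontier wd hi xs.
by apply: Xclosed; split=> //; apply: hb.
Qed.

(** A normal edge copies [t]; a special edge invents a null whose name contains [t], which by
    [null_occurs] cannot occur until strictly after [t]. *)
Lemma realize_edge e alpha t n : dg (simple Sigma) e -> X alpha ->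
  term_at t (source e) alpha -> newer n t ->
  exists beta t', [/\ X beta, term_at t' (target e) beta & newer (n + special e) t'].
Proof.
move=> /(simple_edgeP lin)[s [f [a [b [x [y]]]]]].
move=> [[sS sf ba] [xs p1 p2] [bh yb q1 q2] -> yx] Xa [pa ta] tn.
have [h [ha bk hk Xr]] := match_trigger sS sf ba (etrans (esym p1) pa) Xa.
have et : t = h x.
  have aB : a \in body_of s by rewrite ba in_fset1.
  have [x1 [x1a e1 e2]] := onth_same_kernel bk aB p2.
  move: ta; rewrite -ha e2 => -[<-]; apply/eqP; rewrite -bk ?e1 //.
    by apply/mem_vars; exists a.
  exact: frontier_body.
have [y1 [y1b e1 e2]] := onth_same_kernel hk bh q2.
have yh : y \in vars (head_of s) by apply/mem_vars; exists b.
have {e1}ey : mu s h y1 = mu s h y.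
  by apply/esym/eqP; rewrite -hk ?e1 //; apply/mem_vars; exists b.
rewrite ey in e2.
exists (map_atom (mu s h) b), (mu s h y); split.
- by apply: Xr; apply/resultE; exists b.
- by split=> //; rewrite q1; apply: simple_pred_same_kernel hk bh.
rewrite /mu; case: ifP => ys /=.
  rewrite addn0; have -> // : h y = t.
  by rewrite et; apply/eqP; rewrite -bk ?yx ?frontier_body // ys.
move=> m; rewrite addn1 ltnS => mn occ.
have [m' m'm] := null_occurs wd occ xs; rewrite -et; apply: tn.
exact: leq_trans m'm mn.
Qed.

Lemma realize_walk p es q alpha t n : walk (simple Sigma) p es q -> X alpha ->
  term_at t p alpha -> newer n t ->
  exists beta t', [/\ X beta, term_at t' q beta & newer (n + count (@special _) es) t'].
Proof.
elim: es p alpha t n => [|e es IH] p alpha t n /=.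
  by move=> -> Xa ta tn; exists alpha, t; rewrite addn0.
move=> [dge <- w] Xa ta tn.
have [beta [t1 [Xb tb t1n]]] := realize_edge dge Xa ta tn.
by rewrite addnA; apply: IH w Xb tb t1n.
Qed.

Lemma realize_reach P Q : pred_reach (simple Sigma) P Q ->
  (exists2 alpha, X alpha & simple_pred alpha = P) ->
  exists2 alpha, X alpha & simple_pred alpha = Q.
Proof.
elim=> [P1 Q1 [_ _ [->//|[s' s'S [+ +]]]]|P1 Q1 R1 _ IH1 _ IH2 /IH1/IH2//].
have [s [f [sS sf ->]]] := simpleP lin s'S.
move=> /imfsetP[a' /= /mem_simple_atoms[a aB ->] ->].
move=> /imfsetP[b' /= /mem_simple_atoms[b bh ->] ->] [alpha Xa ea].
have [a0 ba] := lin sS; move: aB; rewrite ba in_fset1 => /eqP ea0; subst a0.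
have [h [_ _ hk Xr]] := match_trigger sS sf ba (esym ea) Xa.
exists (map_atom (mu s h) b); first by apply: Xr; apply/resultE; exists b.
exact/esym/(simple_pred_same_kernel hk bh).
Qed.

Lemma finite_stage : finite_set X -> exists n, (X `<=` u n)%classic.
Proof.
move=> /finite_fsetP[A XA].
have stage (a : atom S term) : a \in A -> exists n, u n a.
  by move=> aA; have [i _ ia] : X a by [rewrite XA]; exists i.
suff [n An] : exists n, forall a : atom S term, a \in enum_fset A -> u n a.
  by exists n => a; rewrite XA => /An.
have {}stage (a : atom S term) : a \in enum_fset A -> exists n, u n a by apply: stage.
elim: (enum_fset A) stage => [|a r IH] stage; first by exists 0.
have [|n rn] := IH; first by move=> b br; apply: stage; rewrite in_cons br orbT.
have [|m am] := stage a; first by rewrite mem_head.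
exists (maxn n m) => b; rewrite in_cons => /orP[/eqP ->|/rn].
  exact: weak_derivation_mono wd _ _ (leq_maxr n m) _ am.
exact: weak_derivation_mono wd _ _ (leq_maxl n m) _.
Qed.

Lemma simple_pred_const (alpha : atom S const) :
  simple_pred (map_atom (inl : const -> term) alpha) = simple_pred alpha.
Proof.
apply: val_inj; congr pair => /=.
rewrite -[args alpha in RHS]map_id; apply: same_kernel_id_of => x y _ _.
by apply/eqP/eqP => [[]|->].
Qed.

Lemma finite_weakly_acyclic :
  finite_set X -> weakly_acyclic (simple_db D) (simple Sigma).
Proof.
move=> finX [es [cyc spec [_ /imfsetP[a0 /= a0D ->] [p pes reach]]]].
have [es' [w]] := cycle_node_walk cyc pes; rewrite spec has_count => spec'.
have [alpha Xa ea] : exists2 alpha, X alpha & simple_pred alpha = p.1.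
  apply: realize_reach reach _; exists (map_atom inl a0).
    by exists 0 => //; rewrite wd.1; exists a0.
  exact: simple_pred_const.
have [t ta] : exists t, term_at t p alpha.
  (* The closed walk has a special edge, so it is not empty and [p] is the source of an edge, hence
     a genuine position. *)
  have : p.2 < size (unique (args alpha)).
    case: (es') w spec' => //= e es1 [/dg_source_arity + ep _] _.
    by rewrite ep -ea -(size_args (simple_atom alpha)).
  rewrite -onthTE; case e: (onth _ _) => [t|//] _.
  by exists t; split.
have [n Xn] := finite_stage finX.
suff [beta [t' [Xb [_ tb] tn]]] : exists beta t',
    [/\ X beta, term_at t' p beta & newer n.+1 t'].
  apply: (tn n) => //; exists beta; first exact: Xn.
  by rewrite -mem_unique; apply/onthP; exists p.2.
(* Each tour of the closed walk passes a special edge and so raises the bound on the stage by at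
   least one. *)
elim: n.+1 => [|k [beta [t' [Xb tb tn]]]]; first by exists alpha, t.
have [gamma [t2 [Xg tg t2n]]] := realize_walk w Xb tb tn.
exists gamma, t2; split=> // m mk; apply: t2n; apply: leq_trans mk _.
by rewrite -addn1 leq_add2l.
Qed.
End Realization.

(** * Ranks of positions *)

Section Rank.
Variables (S : signature) (D : {fset atom S const}) (Sigma : {fset tgd S}).
Implicit Types (p q : position S) (e : edge S).

Definition special_reach p q : Prop :=
  exists es, walk Sigma p es q /\ has (@special S) es.

Definition in_region (P : predicate S) : Prop :=
  exists2 a, a \in D & pred_reach Sigma (pred_of a) P.

(** A full rectangle that contains all nodes; some pairs exceed the arity of their predicate, but
    the size is a plain product. *)
Definition positions : seq (position S) :=
  [seq (P, i) | P <- sch Sigma, i <- iota 0 (ar Sigma)].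

Definition rank p : nat := count (fun q => `[< special_reach q p >]) positions.

Lemma arity_le_ar P : P \in sch Sigma -> arity P <= ar Sigma.
Proof. by move=> PS; exact: (@leq_bigmax_seq _ (enum_fset (sch Sigma)) xpredT (@arity S) P PS). Qed.

Lemma mem_positions p : p.1 \in sch Sigma -> p.2 < arity p.1 -> p \in positions.
Proof.
case: p => P i /= PS iP; apply/allpairsP; exists (P, i); split=> //=.
by rewrite mem_iota /= add0n (leq_trans iP) ?arity_le_ar.
Qed.

Lemma mem_atoms s a : s \in Sigma -> a \in body_of s \/ a \in head_of s ->
  a \in atoms Sigma.
Proof.
by move=> sS H; apply/bigfcupP; exists s; rewrite ?sS // in_fsetU; apply/orP.
Qed.

Lemma mem_sch a : a \in atoms Sigma -> pred_of a \in sch Sigma.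
Proof. by move=> aS; apply/imfsetP; exists a. Qed.

Lemma source_positions e : dg Sigma e -> source e \in positions.
Proof.
move=> dge; apply: mem_positions; last exact: dg_source_arity dge.
by case: dge => [s x a b p q sS _ ab [e1 e2]|s x z a b p q sS _ ab [e1 e2]] *;
  rewrite /source /= e1; apply/mem_sch/(mem_atoms sS); left.
Qed.

Lemma rank_edge e : dg Sigma e -> rank (source e) <= rank (target e).
Proof.
move=> dge; apply: sub_count => q /asboolP[es [w hs]]; apply/asboolP.
exists (es ++ [:: e]); split; last by rewrite has_cat hs.
by apply: walk_cat w _ => /=.
Qed.

Hypothesis wa : weakly_acyclic D Sigma.

Lemma special_reach_irrefl p : in_region p.1 -> ~ special_reach p p.
Proof.
move=> [a aD ap] [es [w hs]]; apply: wa; exists es; split=> //.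
  exact: walk_cycle w.
exists a => //; exists p => //.
by case: es w hs => // e es [_ <- _] _; rewrite mem_cat mem_head.
Qed.

(** The position [p] is not counted in its own rank, since that would close a supported special
    cycle. *)
Lemma rank_lt_size p : p \in positions -> in_region p.1 -> rank p < size positions.
Proof.
move=> pP /special_reach_irrefl irr; rewrite ltn_neqAle count_size andbT.
by rewrite -all_count; apply/allPn; exists p => //; apply/asboolP.
Qed.

(** All that is counted for the source is counted for the target; the source itself is counted only
    for the target. *)
Lemma rank_special e : dg Sigma e -> special e -> in_region (source e).1 ->
  rank (source e) < rank (target e).
Proof.
move=> dge spe /special_reach_irrefl irr; rewrite /rank.
have rt q : special_reach q (source e) -> special_reach q (target e).
  move=> [es [w hs]]; exists (es ++ [:: e]); split; last by rewrite has_cat hs.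
  by apply: walk_cat w _.
have est : special_reach (source e) (target e) by exists [:: e]; rewrite /= spe.
elim: positions (source_positions dge) => //= q r IH.
have le : count (fun q => `[< special_reach q (source e) >]) r <=
          count (fun q => `[< special_reach q (target e) >]) r.
  by apply: sub_count => x /asboolP/rt/asboolP.
rewrite in_cons => /orP[/eqP <-|/IH lt].
  by rewrite (asboolF irr) (asboolT est) add0n add1n ltnS.
rewrite -addnS leq_add //.
by case: (asboolP (special_reach q (source e))) => // /rt/asboolT ->.
Qed.

End Rank.

(** * Counting *)

Fixpoint words (k n : nat) : seq (seq nat) :=
  if n is n'.+1 then [seq i :: w | i <- iota 0 k, w <- words k n'] else [:: [::]].

Lemma size_words k n : size (words k n) = k ^ n.
Proof. by elim: n => //= n IH; rewrite size_allpairs size_iota IH expnS. Qed.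

Lemma mem_words k (w : seq nat) : all (fun i => i < k) w -> w \in words k (size w).
Proof.
elim: w => //= i w IH /andP[ik wk]; apply/allpairsP; exists (i, w).
by rewrite mem_iota IH.
Qed.

(** Encodes a tuple by the places of its entries in a fixed list; it serves to count simplified
    predicates, frontier assignments and atoms over a given tuple. *)
Lemma mem_words_index (T : eqType) (s r : seq T) k : {subset r <= s} -> size s <= k ->
  [seq index x s | x <- r] \in words k (size r).
Proof.
move=> rs sk; rewrite -(size_map (fun x => index x s)); apply: mem_words.
by apply/allP => _ /mapP[x xr ->]; rewrite (leq_trans _ sk) // index_mem rs.
Qed.

Lemma size_allpairs_dep_le (A : eqType) (B C : Type) (f : A -> B -> C) (s : seq A)
    (t : A -> seq B) n : {in s, forall x, size (t x) <= n} ->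
  size [seq f x y | x <- s, y <- t x] <= size s * n.
Proof.
rewrite size_allpairs_dep; elim: s => //= x s IH tn.
rewrite mulSn leq_add ?tn ?mem_head //.
by apply: IH => y ys; apply: tn; rewrite in_cons ys orbT.
Qed.

Lemma leq_expn_base (m n k : nat) : 0 < k -> m <= n -> m <= n ^ k.
Proof.
case: n => [|n] k0 mn; first by move: mn; rewrite leqn0 => /eqP ->.
by apply: leq_trans mn _; rewrite -{1}(expn1 n.+1) leq_pexp2l.
Qed.

Section SizeBounds.
Variables (S : signature) (Sigma : {fset tgd S}).
Hypothesis lin : forall s, s \in Sigma -> linear s.

Lemma simple_sch P : P \in sch (simple Sigma) ->
  exists b (f : var -> var), b \in atoms Sigma /\ P = simple_pred (map_atom f b).
Proof.
move=> /imfsetP[a' /= /bigfcupP[s']]; rewrite andbT => /(simpleP lin)[s [f [sS sf ->]]].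
rewrite in_fsetU => /orP[] /mem_simple_atoms[b bs ->] ->; exists b, f; split=> //.
  by apply: (mem_atoms sS); left.
by apply: (mem_atoms sS); right.
Qed.

Lemma ar_gt0 P : P \in sch Sigma -> 0 < ar Sigma.
Proof. by move=> /arity_le_ar; apply: leq_trans; apply: arity_gt0. Qed.

Lemma size_words_le R : R \in sch Sigma ->
  size (words (ar Sigma) (arity R)) <= ar Sigma ^ ar Sigma.
Proof. by move=> RS; rewrite size_words leq_pexp2l ?arity_le_ar ?(ar_gt0 RS). Qed.

Lemma card_simple_sch : #|` sch (simple Sigma)| <= #|` sch Sigma| * ar Sigma ^ ar Sigma.
Proof.
(* [succn] because ids start at 1 and letters of words at 0. *)
pose W := [seq (R, map succn w) | R <- sch Sigma, w <- words (ar Sigma) (arity R)].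
have sW : size W <= #|` sch Sigma| * ar Sigma ^ ar Sigma.
  by apply: size_allpairs_dep_le => R; apply: size_words_le.
apply: leq_trans sW; rewrite -(size_map val); apply: uniq_leq_size.
  by rewrite map_inj_uniq ?fset_uniq //; apply: val_inj.
move=> _ /mapP[P /simple_sch[b [f [bS ->]]] ->].
apply/allpairsPdep; exists (pred_of b),
  [seq index x (unique (map f (args b))) | x <- map f (args b)].
split; first exact: mem_sch.
  rewrite -[arity _](size_args b) -(size_map f); apply: mem_words_index.
    by move=> x; rewrite mem_unique.
  rewrite size_rev (leq_trans (size_undup _)) // size_rev size_map size_args.
  by rewrite arity_le_ar ?mem_sch.
by congr pair; rewrite -map_comp.
Qed.

Lemma ar_simple : ar (simple Sigma) <= ar Sigma.
Proof.
apply/bigmax_leqP_seq => P /simple_sch[b [f [bS ->]]] _.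
rewrite -(size_args (simple_atom (map_atom f b))) /args /=.
rewrite size_rev (leq_trans (size_undup _)) // size_rev size_map -/(args b).
by rewrite size_args arity_le_ar ?mem_sch.
Qed.

Lemma size_positions : size (positions (simple Sigma)) <= d_L Sigma.
Proof.
rewrite size_allpairs size_iota /d_L expnSr mulnA.
by rewrite leq_mul ?card_simple_sch ?ar_simple.
Qed.
End SizeBounds.

(** * The bound on the chase *)

Section Generations.
Variables (S : signature) (Sigma : {fset tgd S}).
Hypothesis lin : forall s, s \in Sigma -> linear s.
Implicit Types (s : tgd S) (h : var -> term) (b : atom S var) (a : atom S const).

Definition head_pairs : seq (tgd S * atom S var) :=
  [seq (s, b) | s <- Sigma, b <- head_of s].

(** The word [w] tells, for the frontier variables in their listed order, which entry of [gamma]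
    each one takes; the head assignment depends on nothing else. *)
Definition offspring (gamma : seq term) : seq (seq term) :=
  [seq map (mu sb.1 (fun x => nth (inl 0) gamma (nth 0 w (index x (frontier sb.1)))))
           (args sb.2)
     | sb <- head_pairs, w <- words (ar Sigma) #|` frontier sb.1|].

(* An over-approximation of the chase: offspring reads the frontier of a TGD   *)
(* off any tuple, without asking for a trigger.                                *)
Fixpoint generation a0 (j : nat) : seq (seq term) :=
  if j is j'.+1 then [seq delta | gamma <- generation a0 j', delta <- offspring gamma]
  else [:: args (map_atom (inl : const -> term) a0)].

Lemma head_pairsP s b : reflect (s \in Sigma /\ b \in head_of s) ((s, b) \in head_pairs).
Proof.
apply: (iffP allpairsPdep) => [[s' [b' [sS bh [-> ->]]]]|[sS bh]]; first by [].
by exists s, b.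
Qed.

(** Arities are positive, so a head atom contains a variable, and by disjointness that variable
    determines the TGD. *)
Lemma size_head_pairs : variable_disjoint Sigma -> size head_pairs <= #|` atoms Sigma|.
Proof.
move=> disj; rewrite -(size_map snd); apply: uniq_leq_size; last first.
  by move=> _ /mapP[[s b] /head_pairsP[sS bh] ->]; apply: (mem_atoms sS); right.
rewrite map_inj_in_uniq => [|[s b] [s' b'] /head_pairsP[sS bh] /head_pairsP[sS' bh'] /= eb].
  apply: allpairs_uniq_dep => [|s _|[s b] [s' b'] _ _ /=]; rewrite ?fset_uniq //.
  by case=> -> ->.
subst b'; congr pair; apply: contrapT => ne.
have [x xb] : exists x, x \in args b.
  have := arity_gt0 (pred_of b); rewrite -size_args.
  by case: (args b) => // x r _; exists x; rewrite mem_head.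
have xv t : b \in head_of t -> x \in vars (body_of t `|` head_of t).
  by move=> bt; apply/mem_vars; exists b; rewrite // in_fsetU bt orbT.
by have /fdisjointP/(_ x (xv _ bh)) := disj _ _ sS sS' ne; rewrite xv.
Qed.

Lemma card_frontier s : s \in Sigma -> #|` frontier s| <= ar Sigma.
Proof.
move=> sS; have [a ba] := lin sS.
have aS : a \in atoms Sigma by apply: (mem_atoms sS); rewrite ba in_fset1; left.
apply: leq_trans (arity_le_ar (mem_sch aS)); rewrite -size_args.
apply: uniq_leq_size; first exact: fset_uniq.
by move=> x /frontier_body; rewrite ba vars1.
Qed.

Lemma mem_offspring s h b gamma : s \in Sigma -> b \in head_of s ->
  {in frontier s, forall x, h x \in gamma} -> size gamma <= ar Sigma ->
  args (map_atom (mu s h) b) \in offspring gamma.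
Proof.
move=> sS bh hg sg; apply/allpairsPdep.
exists (s, b), [seq index y gamma | y <- map h (frontier s)]; split=> /=.
- exact/head_pairsP.
- rewrite -[#|` _|](size_map h); apply: mem_words_index => //.
  by move=> _ /mapP[x xs ->]; apply: hg.
apply/eq_map/mu_eq => x xs.
have ix : index x (frontier s) < size (frontier s) by rewrite index_mem.
rewrite (nth_map (h x)) ?size_map // (nth_map x) // nth_index // nth_index //.
exact: hg.
Qed.

Lemma size_generation_mem a0 j gamma : pred_of a0 \in sch Sigma ->
  gamma \in generation a0 j -> size gamma <= ar Sigma.
Proof.
move=> a0S; case: j => [|j] /=.
  by rewrite mem_seq1 => /eqP ->; rewrite size_map size_args arity_le_ar.
move=> /allpairsPdep[g [_ [_ /allpairsPdep[[s b] [w [/head_pairsP[sS bh] _ ->]]] ->]]].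
by rewrite size_map size_args arity_le_ar // mem_sch //; apply: (mem_atoms sS); right.
Qed.

Hypothesis disj : variable_disjoint Sigma.

Lemma size_offspring gamma :
  size (offspring gamma) <= #|` atoms Sigma| * ar Sigma ^ ar Sigma.
Proof.
apply: leq_trans (leq_mul (size_head_pairs disj) (leqnn _)).
apply: size_allpairs_dep_le => -[s b] /head_pairsP[sS bh] /=.
rewrite size_words leq_pexp2l ?card_frontier //.
by apply: (@ar_gt0 _ _ (pred_of b)); apply: mem_sch; apply: (mem_atoms sS); right.
Qed.

Lemma size_generation a0 j :
  size (generation a0 j) <= (#|` atoms Sigma| * ar Sigma ^ ar Sigma) ^ j.
Proof.
elim: j => //= j IH; rewrite expnSr; apply: leq_trans (leq_mul IH (leqnn _)).
by apply: size_allpairs_dep_le => gamma _; apply: size_offspring.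
Qed.

(** A fact whose predicate is outside the schema fires nothing and contributes only itself. Raw
    pairs are listed instead of atoms, to avoid arity proofs. *)
Definition descendants a0 : seq (predicate S * seq term) :=
  if pred_of a0 \in sch Sigma then
    [seq (Rw.1, map (nth (inl 0) gamma) Rw.2)
       | gamma <- [seq gamma | j <- iota 0 (d_L Sigma).+1, gamma <- generation a0 j],
         Rw <- [seq (R, w) | R <- sch Sigma, w <- words (ar Sigma) (arity R)]]
  else [:: atom_val (map_atom (inl : const -> term) a0)].

Lemma tgd_norm_gt0 R : R \in sch Sigma -> 0 < tgd_norm Sigma.
Proof.
move=> RS; rewrite /tgd_norm !muln_gt0 (ar_gt0 RS) andbT !cardfs_gt0.
apply/andP; split; apply/fset0Pn; last by exists R.
by case/imfsetP: RS => a /= aS _; exists a.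
Qed.

Lemma f_L_gt0 : 0 < f_L Sigma.
Proof.
rewrite muln_gt0 expn_gt0 /=; have [[R RS]|nR] := pselect (exists R, R \in sch Sigma).
  by rewrite (tgd_norm_gt0 RS).
suff -> : ar Sigma = 0 by rewrite muln0 mul0n eqxx orbT.
apply/eqP; rewrite -leqn0; apply/bigmax_leqP_seq => R RS _.
by case: nR; exists R.
Qed.

(** With A atoms, s predicates and M = ar^ar there are at most (d + 1)(AM)^d tuples, each carrying
    at most sM atoms; both AM and sM are at most N^ar for N = [tgd_norm Sigma]. *)
Lemma size_descendants a0 : size (descendants a0) <= f_L Sigma.
Proof.
rewrite /descendants; case: ifP => [RS|_]; last exact: f_L_gt0.
have arp := ar_gt0 RS; have Np := tgd_norm_gt0 RS.
set M := ar Sigma ^ ar Sigma; set N := tgd_norm Sigma in Np *.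
have : 0 < N by []; rewrite !muln_gt0 => /andP[/andP[Ap Sp] _].
have AM : #|` atoms Sigma| * M <= N ^ ar Sigma.
  apply: leq_trans (leq_mul (leq_expn_base arp (leqnn _)) (leqnn M)) _.
  by rewrite -expnMn leq_exp2r // leq_mul // leq_pmulr.
have SM : #|` sch Sigma| * M <= N ^ ar Sigma.
  apply: leq_trans (leq_mul (leq_expn_base arp (leqnn _)) (leqnn M)) _.
  by rewrite -expnMn leq_exp2r // leq_mul // leq_pmull.
have AMp : 0 < #|` atoms Sigma| * M by rewrite muln_gt0 Ap expn_gt0 arp.
rewrite size_allpairs /f_L -/N mulnC.
(* The first summand pays for the atoms over a tuple, the second for the tuples of a generation; the
   third is slack. *)
have -> : 2 * ar Sigma * (d_L Sigma).+1 =
          (ar Sigma + (ar Sigma * d_L Sigma + ar Sigma * (d_L Sigma).+1))%N by lia.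
rewrite expnD mulnCA leq_mul //.
  apply: leq_trans SM; apply: size_allpairs_dep_le => R' R'S.
  exact: size_words_le.
rewrite -[X in X * _](size_iota 0); apply: size_allpairs_dep_le => j.
rewrite mem_iota add0n ltnS => /andP[_ jd].
apply: leq_trans (size_generation a0 j) _.
apply: leq_trans (leq_pexp2l AMp jd) _.
rewrite expnD expnM; apply: leq_trans (leq_pmulr _ _); last by rewrite expn_gt0 Np.
by rewrite leq_exp2r // muln_gt0 Sp expn_gt0 arp.
Qed.
End Generations.

(** * Terms of low rank lie in early generations *)

Section Bound.
Variables (S : signature) (D : {fset atom S const}) (Sigma : {fset tgd S}).
Variable u : nat -> set (atom S term).
Hypothesis lin : forall s, s \in Sigma -> linear s.
Hypothesis wd : weak_derivation D Sigma u.
Hypothesis wa : weakly_acyclic (simple_db D) (simple Sigma).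
Implicit Types (s : tgd S) (h : var -> term) (b : atom S var).

(** Invariant of the chase. For each [k] a single tuple must hold all terms of rank at most [k],
    since successors are formed from one tuple; it may change with [k]. *)
Definition derived (a0 : atom S const) (beta : atom S term) : Prop :=
  (beta = map_atom inl a0 \/
   [/\ pred_of a0 \in sch Sigma, pred_of beta \in sch Sigma &
       pred_reach (simple Sigma) (simple_pred a0) (simple_pred beta)]) /\
  (forall k, exists j gamma, [/\ j <= k.+1, gamma \in generation Sigma a0 j &
        forall p t, term_at t p beta -> rank (simple Sigma) p <= k -> t \in gamma]).

Lemma derived_database a0 : derived a0 (map_atom inl a0).
Proof.
split=> [|k]; first by left.
 exists 0, (args (map_atom (inl : const -> term) a0)); split=> //.
  by rewrite mem_head.
by move=> p t [_ pt] _; rewrite -mem_unique; apply/onthP; exists p.2.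
Qed.

Lemma mem_simple_sch s f b : simple_tgd_by s f \in simple Sigma ->
  b \in body_of s \/ b \in head_of s ->
  simple_pred (map_atom f b) \in sch (simple Sigma).
Proof.
move=> sfS bs; rewrite -[simple_pred _]/(pred_of (simple_atom (map_atom f b))).
apply/mem_sch/(mem_atoms sfS); case: bs => bs; [left|right];
  by apply/mem_simple_atoms; exists b.
Qed.

Lemma derived_step a0 alpha i s h b : a0 \in D -> derived a0 alpha ->
  s \in Sigma -> u i alpha -> (forall a, a \in body_of s -> map_atom h a = alpha) ->
  b \in head_of s -> derived a0 (map_atom (mu s h) b).
Proof.
move=> a0D [orig gens] sS ia ha bh; have [a ba] := lin sS.
have aB : a \in body_of s by rewrite ba in_fset1.
have [f [sf bk sfS]] := simple_tgd_ex h lin sS.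
have hb : homomorphism h (body_of s) (u i) by move=> a1 /ha ->.
have hk : same_kernel (vars (head_of s)) f (mu s h).
  by apply: head_same_kernel => // x y xs; apply: null_neq_frontier wd hb xs.
have e_alpha : simple_pred alpha = simple_pred (map_atom f a).
  by rewrite -(ha a aB); apply/esym/(simple_pred_same_kernel bk aB).
have e_beta := simple_pred_same_kernel hk bh.
have S_alpha : simple_pred (map_atom f a) \in sch (simple Sigma).
  by apply: mem_simple_sch sfS _; left.
have pS : pred_of alpha \in sch Sigma.
  by rewrite -(ha a aB); apply/mem_sch/(mem_atoms sS); left.
have a0S : pred_of a0 \in sch Sigma by case: orig => [e|[]//]; rewrite e in pS.
have reach_alpha : pred_reach (simple Sigma) (simple_pred a0) (simple_pred alpha).
  case: orig => [e|[]//]; apply: Relation_Operators.t_step.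
  have -> : simple_pred a0 = simple_pred alpha by rewrite e simple_pred_const.
  by rewrite e_alpha; split=> //; left.
have region : in_region (simple_db D) (simple Sigma) (simple_pred alpha).
  by exists (simple_atom a0) => //; apply/imfsetP; exists a0.
(* As [f] has the kernels of [h] and of [mu s h], edges can be read off the actual terms of the
   trigger. *)
have edge_at x i1 y j1 : x \in frontier s -> y \in args b ->
    (y \in frontier s -> h y = h x) ->
    onth (unique (args (map_atom h a))) i1 = Some (h x) ->
    onth (unique (args (map_atom (mu s h) b))) j1 = Some (mu s h y) ->
    dg (simple Sigma) ((simple_pred alpha, i1), y \notin frontier s,
                       (simple_pred (map_atom (mu s h) b), j1)).
  move=> xs yb yx oi oj; rewrite e_alpha -e_beta.
  have bk' : same_kernel (vars (body_of s)) h f by move=> v w ? ?; rewrite bk.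
  have hk' : same_kernel (vars (head_of s)) (mu s h) f by move=> v w ? ?; rewrite hk.
  have [x1 [x1a ex1 ox1]] := onth_same_kernel bk' aB oi.
  have [y1 [y1b ey1 oy1]] := onth_same_kernel hk' bh oj.
  have efx : f x1 = f x.
    apply/eqP; rewrite bk ?ex1 //; last exact: frontier_body.
    by apply/mem_vars; exists a.
  have efy : f y1 = f y.
    by apply/eqP; rewrite hk ?ey1 //; apply/mem_vars; exists b.
  rewrite efx in ox1; rewrite efy in oy1.
  apply: (simple_edge sf sfS aB xs ox1 bh yb _ oy1) => ys.
  by apply/eqP; rewrite bk ?frontier_body // yx.
split.
  right; split=> //; first by apply/mem_sch/(mem_atoms sS); right.
  apply: Relation_Operators.t_trans reach_alpha _.
  apply: Relation_Operators.t_step; rewrite e_alpha -e_beta; split=> //.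
    by apply: mem_simple_sch sfS _; right.
  right; exists (simple_tgd_by s f) => //.
  by split; apply/imfsetP; [exists (simple_atom (map_atom f a))|
    exists (simple_atom (map_atom f b))] => //=; apply/mem_simple_atoms;
    [exists a|exists b].
(* Either an invented null stands at rank at most [k], and the new tuple is a successor of one
   holding the whole frontier, or all terms of such rank are inherited. *)
move=> k; case: (pselect (exists y j1, [/\ y \in args b, y \notin frontier s,
    onth (unique (args (map_atom (mu s h) b))) j1 = Some (mu s h y) &
    rank (simple Sigma) (simple_pred (map_atom (mu s h) b), j1) <= k]))
  => [[y [j1 [yb ys oj rk]]]|old].
  have lower x i1 : x \in frontier s ->
      onth (unique (args (map_atom h a))) i1 = Some (h x) ->
      rank (simple Sigma) (simple_pred alpha, i1) < k.
    move=> xs oi; apply: leq_trans rk.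
    have yx : y \in frontier s -> h y = h x by rewrite (negbTE ys).
    exact: (rank_special wa (edge_at x i1 y j1 xs yb yx oi oj)).
  suff [j [gamma [jk gj hg]]] : exists j gamma, [/\ j <= k,
      gamma \in generation Sigma a0 j & {in frontier s, forall x, h x \in gamma}].
    exists j.+1, (args (map_atom (mu s h) b)); split=> //.
      apply/allpairsPdep; exists gamma, (args (map_atom (mu s h) b)); split=> //.
      by apply: mem_offspring => //; apply: size_generation_mem gj.
    by move=> p t [_ pt] _; rewrite -mem_unique; apply/onthP; exists p.2.
  have pos x : x \in frontier s ->
      exists i1, onth (unique (args (map_atom h a))) i1 = Some (h x).
    move=> xs; apply/onthP; rewrite mem_unique; apply: map_f.
    by have := frontier_body xs; rewrite ba vars1.
  (* For [k = 0] no rank is below [k], so the frontier is empty and the tuple of the fact itself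
     will do. *)
  case: k {rk} lower => [|k] lower.
    exists 0, (args (map_atom (inl : const -> term) a0)); split=> //=.
      by rewrite mem_head.
    by move=> x xs; have [i1 /(lower x _ xs)] := pos x xs.
  have [j [gamma [jk gj hg]]] := gens k; exists j, gamma; split=> // x xs.
  have [i1 oi] := pos x xs; apply: (hg (simple_pred alpha, i1)).
    by split=> //=; rewrite -(ha a aB).
  exact: lower oi.
have [j [gamma [jk gj hg]]] := gens k; exists j, gamma; split=> // -[P j1] t [/= eP ot] rk.
have : t \in args (map_atom (mu s h) b).
  by rewrite -mem_unique; apply/onthP; exists j1.
move=> /mapP[y yb et]; rewrite {}et in ot *; rewrite {}eP in rk.
have ys : y \in frontier s.
  by apply: contraT => ys; case: old; exists y, j1.
have [i1 oi] : exists i1, onth (unique (args (map_atom h a))) i1 = Some (h y).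
  apply/onthP; rewrite mem_unique; apply: map_f.
  by have := frontier_body ys; rewrite ba vars1.
rewrite /mu ys; apply: (hg (simple_pred alpha, i1)).
  by split=> //=; rewrite -(ha a aB).
by apply: leq_trans rk; apply: (rank_edge (edge_at y i1 y j1 _ _ _ _ _)).
Qed.

Lemma stage_derived i beta : u i beta -> exists2 a0, a0 \in D & derived a0 beta.
Proof.
elim: i beta => [|i IH] beta.
  by rewrite wd.1 => -[a0 /= a0D <-]; exists a0 => //; apply: derived_database.
case: (wd.2 i) => [->|[s [h [[[sS hb] _] ->]]]]; first exact: IH.
case=> [/IH//|/resultE[b bh ->]].
have [a ba] := lin sS; have ia : u i (map_atom h a) by apply: hb; rewrite ba in_fset1.
have [a0 a0D a0d] := IH _ ia; exists a0 => //.
apply: derived_step a0D a0d sS ia _ bh => a1.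
by rewrite ba in_fset1 => /eqP ->.
Qed.

Lemma pred_reach_sch (S' : signature) (Sigma' : {fset tgd S'}) P Q :
  pred_reach Sigma' P Q -> Q \in sch Sigma'.
Proof. by elim=> [? ? []|]. Qed.

Lemma derived_descendant a0 beta : a0 \in D -> derived a0 beta ->
  atom_val beta \in descendants Sigma a0.
Proof.
move=> a0D [orig gens]; rewrite /descendants.
case: ifP => [a0S|a0S]; last first.
  by case: orig => [->|[]]; rewrite ?mem_head // a0S.
have bS : pred_of beta \in sch Sigma by case: orig => [->|[]].
suff [j [gamma [jd gj sub]]] : exists j gamma, [/\ j <= d_L Sigma,
    gamma \in generation Sigma a0 j & {subset args beta <= gamma}].
  apply/allpairsP; exists (gamma, (pred_of beta, [seq index t gamma | t <- args beta])).
  split.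
  - apply/allpairsPdep; exists j, gamma; split=> //.
    by rewrite mem_iota add0n ltnS.
  - apply/allpairsPdep; exists (pred_of beta), [seq index t gamma | t <- args beta].
    split=> //; rewrite -size_args; apply: mem_words_index sub _.
    exact: size_generation_mem gj.
  rewrite /= -map_comp [LHS]surjective_pairing; congr pair.
  rewrite -[LHS]map_id; apply/eq_in_map => t tb /=.
  by rewrite nth_index // sub.
case: orig => [->|[_ _ reach]].
  by exists 0, (args (map_atom (inl : const -> term) a0)); split=> //=; rewrite mem_head.
have region : in_region (simple_db D) (simple Sigma) (simple_pred beta).
  by exists (simple_atom a0) => //; apply/imfsetP; exists a0.
have rank_lt i : i < size (unique (args beta)) ->
    rank (simple Sigma) (simple_pred beta, i) < d_L Sigma.
  move=> ib; apply: leq_trans (size_positions lin); apply: (rank_lt_size wa) => //.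
  apply: mem_positions; first exact: pred_reach_sch reach.
  by rewrite -(size_args (simple_atom beta)).
have d0 : 0 < d_L Sigma.
  by rewrite muln_gt0 expn_gt0 (ar_gt0 a0S) andbT cardfs_gt0; apply/fset0Pn; exists (pred_of a0).
(* All ranks are at most d - 1, so this [k] captures every argument within generation d. *)
have [j [gamma [jd gj sub]]] := gens (d_L Sigma).-1.
rewrite prednK // in jd; exists j, gamma; split=> // t tb.
have /onthP[i oi] : t \in unique (args beta) by rewrite mem_unique.
apply: (sub (simple_pred beta, i)) => //.
by rewrite -ltnS prednK // rank_lt // -onthTE oi.
Qed.
End Bound.

(** * Cardinality and the equivalence *)

Local Open Scope card_scope.

Lemma card_le_seq (T : eqType) (U : Type) (f : U -> T) (A : set U) (r : seq T) n :
  injective f -> (forall x, A x -> f x \in r) -> size r <= n -> (A #<= `I_n)%classic.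
Proof.
move=> injf Ar rn; pose g x := index (f x) r.
have injg : {in A &, injective g}.
  move=> x y /set_mem Ax /set_mem Ay exy; apply: injf.
  by rewrite -(nth_index (f x) (Ar x Ax)) -/(g x) exy nth_index // Ar.
rewrite -(card_le_eql (inj_card_eq injg)); apply: subset_card_le.
by move=> _ [x Ax <-] /=; rewrite (leq_trans _ rn) // index_mem Ar.
Qed.

Theorem theorem7p5 (S : signature) (D : {fset atom S const})
    (Sigma : {fset tgd S})
    (Sigma_disjoint : variable_disjoint Sigma)
    (Sigma_linear : forall s, s \in Sigma -> linear s) :
  [<-> CT D Sigma;
       (chase D Sigma #<= `I_(#|` D| * f_L Sigma))%classic;
       weakly_acyclic (simple_db D) (simple Sigma)].
Proof.
have [u [wd eX closed]] := chase_derivation D Sigma_linear.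
have CT_wa : CT D Sigma -> weakly_acyclic (simple_db D) (simple Sigma).
  rewrite /CT eX; apply: finite_weakly_acyclic => //.
  by rewrite -eX.
have wa_bound : weakly_acyclic (simple_db D) (simple Sigma) ->
    (chase D Sigma #<= `I_(#|` D| * f_L Sigma))%classic.
  move=> wa; apply: (@card_le_seq _ _ (@atom_val S term) _
    [seq v | a <- D, v <- descendants Sigma a]); first exact: val_inj.
    move=> beta; rewrite eX => -[i _ /(stage_derived Sigma_linear wd wa)[a aD der]].
    apply/allpairsPdep; exists a, (atom_val beta); split=> //.
    exact: (derived_descendant Sigma_linear wa).
  by apply: size_allpairs_dep_le => a _; apply: size_descendants.
have bound_CT : (chase D Sigma #<= `I_(#|` D| * f_L Sigma))%classic -> CT D Sigma.
  by move=> le; apply: card_le_finite le (finite_II _).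
(* The proved cycle (1), (3), (2), (1) runs against the order of the list, so each implication is a
   composite of two. *)
by tfae=> [/CT_wa/wa_bound|/bound_CT/CT_wa|/wa_bound/bound_CT].
Qed.
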